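(* (1) Let $G$ and its convex conjugate $G^*$ be differentiable on their domains, and let $\Psi$ be an energy function. Then the following are equivalent: (i) $G$ is $\mathcal{H}(\Psi)$-smooth; (ii) $G^*$ is $\mathcal{H}(\Psi^* )$-convex. (2) Let $a>0$, $b>0$, $c\in\mathbb{R}$ and define $F(x):=aG(bx)+c$ on $\{x: bx\in\mathrm{dom}\,G\}$. If $G$ is $\mathcal{H}(\Psi)$-smooth, then $F$ is $\mathcal{H}(a\Psi(b\,\cdot))$-smooth. If $G$ is $\mathcal{H}(\psi)$-convex, then $F$ is $\mathcal{H}(a\psi(b\,\cdot))$-convex. (3) Let $s$ be a finite dataset of points of $\mathcal{Z}$ and $G(\theta,s)=\frac{1}{|s|}\sum_{z\in s}G(\theta,z)$. If $G(\cdot,z)$ has the same generalized convexity and smoothness properties in $\theta$ for all $z\in\mathcal{Z}$ (i.e. is $\mathcal{H}(\Psi)$-smooth for all $z$ with one common $\Psi$, respectively $\mathcal{H}(\psi)$-convex for all $z$ with one common $\psi$), then $\theta\mapsto G(\theta,s)$ has the same properties (is $\mathcal{H}(\Psi)$-smooth, respectively $\mathcal{H}(\psi)$-convex). (4) Let $s$ be a fixed constant vector. If $G$ is $\mathcal{H}(\psi)$-convex, then $d_G(\cdot,s)$ has the same generalized convexity and smoothness properties as $G(\cdot)$ (it is $\mathcal{H}(\Psi)$-smooth, resp. $\mathcal{H}(\psi)$-convex, for the same energy functions as $G$), and $d_G(s,\cdot)$ has the same generalized convexity and smoothness properties as $G^*(\cdot)$.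
   Context: All functions are continuous, proper, and defined on convex domains. At any point where a function $G$ is not differentiable, $\nabla G$ is set to $\mathbf{0}$ by convention. Energy function: a function $\Psi:\mathbb{R}^m\to\mathbb{R}$ that is a Legendre function (proper, lower semicontinuous, convex, essentially smooth and essentially strictly convex), whose unique minimum is attained at the origin, and which has the radial form $\Psi(\mu)=\Psi_\circ(\|\mu\|)$ for some norm $\|\cdot\|$ on $\mathbb{R}^m$. First-order Taylor remainder: $S_G(\mu,\nu)=G(\mu)-G(\nu)-\langle\nabla G(\nu),\mu-\nu\rangle$. $G$ is $\mathcal{H}(\Psi)$-smooth if $\Psi$ is an energy function and $S_G(\mu,\nu)\le\Psi(\mu-\nu)$ for all $\mu,\nu\in\mathrm{dom}(G)$. $G$ is $\mathcal{H}(\psi)$-convex if $\psi$ is an energy function and $S_G(\mu,\nu)\ge\psi(\mu-\nu)$ for all $\mu,\nu\in\mathrm{dom}(G)$. Convex conjugate: $G^*(\nu)=\sup_{\mu\in\mathrm{dom}(G)}\{\langle\mu,\nu\rangle-G(\mu)\}$. Fenchel--Young loss: $d_G(\mu,\nu)=G(\mu)+G^*(\nu)-\langle\mu,\nu\rangle$.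
   Formalization: Energies may be +∞; (1) assumes G lsc; (3) assumes that at each point all G(·,z), z in s, are differentiable, or none is nor is the mean; (4) assumes s in dom G*, resp. dom G, and G differentiable on its domain, resp. G* differentiable if ψ(0)<0. *)

(* Defs.v *)
(* MathComp / MathComp-Analysis. *)
From HB Require Import structures.
From mathcomp Require Import all_boot all_order all_algebra.
From mathcomp Require Import all_classical all_reals all_analysis.

Set Implicit Arguments.
Unset Strict Implicit.
Unset Printing Implicit Defensive.

Import Order.TTheory GRing.Theory Num.Theory.
Import numFieldNormedType.Exports.

Local Open Scope classical_set_scope.
Local Open Scope ring_scope.

(* A function on a convex domain of R^m is a total function 'rV[R]_m -> \bar R
   with value +oo off its domain. *)
Section Defs.
Context {R : realType} {m : nat}.
Local Notation V := ('rV[R]_m).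
Implicit Types (G f : V -> \bar R) (x y mu nu : V).

Definition dot x y : R := \sum_(i < m) x 0 i * y 0 i.

Definition dom G : set V := [set x | (G x < +oo)%E].

Definition proper_fun G : Prop :=
  (forall x, (-oo < G x)%E) /\ dom G !=set0.

Definition standing G : Prop :=
  [/\ proper_fun G, convex_set (dom G) & {within dom G, continuous G}].

(* Fréchet differentiability in the ambient space: G is finite near x, so x is
   an interior point of the domain. *)
Definition differentiable_at G x : Prop :=
  (\forall y \near x, G y \is a fin_num) /\ differentiable (fine \o G) x.

Definition differentiable_on_dom G : Prop :=
  forall x, dom G x -> differentiable_at G x.

Definition grad G x : V :=
  if `[< differentiable_at G x >]
  then \row_(i < m) 'D_(delta_mx 0 i : V) (fine \o G) x
  else 0.

Definition taylor_rem G mu nu : \bar R :=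
  (G mu - G nu - (dot (grad G nu) (mu - nu)%R)%:E)%E.

Definition conjugate G nu : \bar R :=
  ereal_sup [set ((dot mu nu)%:E - G mu)%E | mu in dom G].

Definition fenchel_young G mu nu : \bar R :=
  (G mu + conjugate G nu - (dot mu nu)%:E)%E.

(* Only 0 < t < 1 is used, so for a proper f the right-hand side involves
   neither 0 * +oo nor +oo - oo. *)
Definition convex_ext f : Prop :=
  forall x y (t : R), 0 < t -> t < 1 ->
    (f (t *: x + (1 - t) *: y)%R <= t%:E * f x + (1 - t)%:E * f y)%E.

Definition strictly_convex_on (C : set V) f : Prop :=
  forall x y (t : R), C x -> C y -> x != y -> 0 < t -> t < 1 ->
    (f (t *: x + (1 - t) *: y)%R < t%:E * f x + (1 - t)%:E * f y)%E.

Definition subdifferential f x : set V :=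
  [set g | dom f x /\ forall y, (f x + (dot g (y - x)%R)%:E <= f y)%E].

(* Essential smoothness and essential strict convexity are those of
   Rockafellar, Convex Analysis, Section 26. *)
Definition essentially_smooth f : Prop :=
  [/\ (dom f)° !=set0,
      forall x, (dom f)° x -> differentiable_at f x
    & forall (u : nat -> V) x, (forall n, (dom f)° (u n)) ->
        u @ \oo --> x -> ~ (dom f)° x ->
        (fun n => `|grad f (u n)|) @ \oo --> +oo].

Definition essentially_strictly_convex f : Prop :=
  forall C : set V, C `<=` [set x | subdifferential f x !=set0] ->
    convex_set C -> strictly_convex_on C f.

Definition legendre f : Prop :=
  [/\ proper_fun f, lower_semicontinuous f, convex_ext f,
      essentially_smooth f & essentially_strictly_convex f].

Definition is_norm (N : V -> R) : Prop :=
  [/\ forall x y, N (x + y) <= N x + N y,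
      forall (a : R) x, N (a *: x) = `|a| * N x
    & forall x, N x = 0 -> x = 0].

Definition radial f : Prop :=
  exists (N : V -> R) (fo : R -> \bar R), is_norm N /\ forall x, f x = fo (N x).

(* The value +oo is allowed, since the conjugate of a finite-valued function
   of this kind need not be finite: the conjugate of sqrt (1 + |x|^2) is
   - sqrt (1 - |y|^2) on the unit ball and +oo outside. *)
Definition energy f : Prop :=
  [/\ legendre f, forall x, x != 0 -> (f 0%R < f x)%E & radial f].

Definition H_smooth (Psi G : V -> \bar R) : Prop :=
  energy Psi /\ forall mu nu, dom G mu -> dom G nu ->
    (taylor_rem G mu nu <= Psi (mu - nu)%R)%E.

Definition H_convex (psi G : V -> \bar R) : Prop :=
  energy psi /\ forall mu nu, dom G mu -> dom G nu ->
    (psi (mu - nu)%R <= taylor_rem G mu nu)%E.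

Definition rescale (a b c : R) G : V -> \bar R :=
  fun x => (a%:E * G (b *: x)%R + c%:E)%E.

Definition dataset_mean (Z : Type) (n : nat) (s : n.-tuple Z)
    (G : Z -> V -> \bar R) : V -> \bar R :=
  fun theta => ((n%:R^-1)%R%:E * \sum_(i < n) G (tnth s i) theta)%E.

(* Where G z fails to be differentiable the convention sets its gradient to 0,
   which is additive in z only if differentiability does not vary with z. *)
Definition uniformly_differentiable_or_not (Z : Type) (n : nat)
    (s : n.-tuple Z) (G : Z -> V -> \bar R) : Prop :=
  forall theta, dom (dataset_mean s G) theta ->
    (forall i, differentiable_at (G (tnth s i)) theta) \/
    ((forall i, ~ differentiable_at (G (tnth s i)) theta) /\
     ~ differentiable_at (dataset_mean s G) theta).

End Defs.

(* Main.v *)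
Require Import Defs.
From HB Require Import structures.
From mathcomp Require Import all_boot all_order all_algebra.
From mathcomp Require Import all_classical all_reals all_analysis.
From mathcomp Require Import ring lra.

Set Implicit Arguments.
Unset Strict Implicit.
Unset Printing Implicit Defensive.

Import Order.TTheory GRing.Theory Num.Theory.
Import numFieldNormedType.Exports.

Local Open Scope classical_set_scope.
Local Open Scope ring_scope.

(* (1) If y0 is in dom G^* and nu = grad G^*(y0), then nu maximises <., y0> - G
   (Smulian), so that grad G(nu) = y0. (i) forces G to be finite
   everywhere, so G^*(y) is at least the supremum over all mu of
   <mu, y> - G(nu) - <y0, mu - nu> - Psi(mu - nu), which is the desired lower
   bound with Psi^*(y - y0). From (ii), the range of grad G^*
   contains a ball of fixed radius around each of its points, hence is
   everything, and the bound for G follows by conjugating back. That Psi^* is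
   again an energy function is Legendre duality: for essentially strictly
   convex Psi a maximiser of <., y> - Psi is unique and strong, which makes
   Psi^* differentiable at y (so y is interior and gradients blow up at the
   boundary), while essential smoothness of Psi separates subgradients and
   makes Psi^* essentially strictly convex.
   (2), (3) Taylor remainders are equivariant under rescaling and averaging.
   (4) Adding an affine function does not change Taylor remainders. For the
   second variable this needs G^* differentiable: if psi(0) >= 0, H-convexity
   gives a uniform convexity inequality at midpoints, hence almost maximisers
   of <., y> - G form a Cauchy family and the maximum is strong. *)

(** * Dot product and first-order expansions *)

Section Dot.
Context {R : realType} {m : nat}.
Implicit Types x y z : 'rV[R]_m.

Lemma dotC x y : dot x y = dot y x.
Proof. by apply: eq_bigr => i _; rewrite mulrC. Qed.

Lemma dotDr x y z : dot x (y + z) = dot x y + dot x z.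
Proof. by rewrite -big_split; apply: eq_bigr => i _; rewrite mxE mulrDr. Qed.

Lemma dotZr a x y : dot x (a *: y) = a * dot x y.
Proof. by rewrite mulr_sumr; apply: eq_bigr => i _; rewrite mxE mulrCA. Qed.

Lemma dotNr x y : dot x (- y) = - dot x y.
Proof. by rewrite -scaleN1r dotZr mulN1r. Qed.

Lemma dotBr x y z : dot x (y - z) = dot x y - dot x z.
Proof. by rewrite dotDr dotNr. Qed.

Lemma dot0r x : dot x 0 = 0.
Proof. by rewrite -(subrr x) dotBr subrr. Qed.

Lemma dotDl x y z : dot (x + y) z = dot x z + dot y z.
Proof. by rewrite dotC dotDr !(dotC z). Qed.

Lemma dotZl a x y : dot (a *: x) y = a * dot x y.
Proof. by rewrite dotC dotZr dotC. Qed.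

Lemma dotNl x y : dot (- x) y = - dot x y.
Proof. by rewrite dotC dotNr dotC. Qed.

Lemma dotBl x y z : dot (x - y) z = dot x z - dot y z.
Proof. by rewrite dotDl dotNl. Qed.

Lemma dot0l x : dot 0 x = 0.
Proof. by rewrite dotC dot0r. Qed.

Definition dotE := (dotDr, dotDl, dotNr, dotNl, dotZr, dotZl, dot0r, dot0l).

Lemma normv_coord x i : `|x 0 i| <= `|x|.
Proof.
rewrite [leRHS]mx_normrE.
by apply: (le_trans _ (le_bigmax _ (fun ij => `|x ij.1 ij.2|) (0, i))).
Qed.

(** The ambient norm on row vectors is the sup norm, so each of the [m] products of coordinates is
    at most the product of the norms. *)
Lemma dot_norm_le x y : `|dot x y| <= m%:R * `|x| * `|y|.
Proof.
rewrite /dot (le_trans (ler_norm_sum _ _ _))//.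
have -> : m%:R * `|x| * `|y| = \sum_(i < m) `|x| * `|y|.
  by rewrite sumr_const card_ord -[RHS]mulr_natl mulrA.
apply: ler_sum => i _; rewrite normrM.
by apply: ler_pM => //; exact: normv_coord.
Qed.

(** With [m.+1] in place of [m] the constant is positive even in dimension 0, so later proofs can
    divide by it. *)
Lemma dot_le x y : dot x y <= m.+1%:R * `|x| * `|y|.
Proof.
rewrite (le_trans (ler_norm _))// (le_trans (dot_norm_le x y))//.
by rewrite -!mulrA ler_wpM2r ?mulr_ge0// ler_nat.
Qed.

Lemma dot_delta x i : dot x (delta_mx 0 i) = x 0 i.
Proof.
rewrite /dot (bigD1 i)//= !mxE !eqxx mulr1 big1 ?addr0// => j ji.
by rewrite mxE (negPf ji) andbF mulr0.
Qed.

Lemma norm_delta i : `|delta_mx 0 i : 'rV[R]_m| <= 1.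
Proof.
rewrite [leLHS]mx_normrE; apply/bigmax_leP; split => //= -[j k] _ /=.
by rewrite mxE; case: (_ && _); rewrite ?normr1 ?normr0.
Qed.

(** The sup norm is attained at some coordinate; the basis vector there, signed like that
    coordinate, is the witness. *)
Lemma dot_normer x : exists2 e : 'rV[R]_m, `|e| <= 1 & dot x e = `|x|.
Proof.
have [->|x0] := eqVneq x 0; first by exists 0; rewrite ?normr0 ?dot0r ?ler01.
have [|[j i]] := @mx_norm_neq0 R 1 m x.
  by rewrite (_ : mx_norm x = `|x|)// normr_eq0.
rewrite [LHS](_ : _ = `|x|)// ord1 /= => ->.
exists (Num.sg (x 0 i) *: delta_mx 0 i).
  rewrite normrZ -[leRHS]mul1r ler_pM ?norm_delta//.
  by rewrite normr_sg; case: (_ != _).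
by rewrite dotZr dot_delta normrEsg.
Qed.

Lemma dotxx_le0 x : dot x x <= 0 -> x = 0.
Proof.
move=> h; have h0 i : 0 <= x 0 i * x 0 i by rewrite -expr2 sqr_ge0.
have := psumr_eq0P (fun i (_ : true) => h0 i).
have -> : \sum_(i < m) x 0 i * x 0 i = 0.
  by apply/eqP; rewrite eq_le h sumr_ge0.
move=> /(_ erefl) h1; apply/rowP => i; rewrite mxE; apply/eqP.
by have /eqP := h1 i isT; rewrite mulf_eq0 orbb.
Qed.

Lemma nearvP x (P : set 'rV[R]_m) :
  (\forall y \near x, P y) <->
  exists2 d : R, 0 < d & forall z : 'rV[R]_m, `|z| < d -> P (x + z).
Proof.
rewrite nbhs0P; split=> [/nbhs_norm0P[d d0 h]|[d d0 h]].
  by exists d => // z zd; exact: h.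
by apply/nbhs_norm0P; exists d.
Qed.

Lemma dotr_is_linear x : linear (dot x : 'rV[R]_m -> R^o).
Proof. by move=> a y z; rewrite dotDr dotZr. Qed.

End Dot.

(** The linear structure lets [dot g] stand for a differential in [diff_unique]. *)
HB.instance Definition _ (R : realType) m (x : 'rV[R]_m) :=
  GRing.isLinear.Build R 'rV[R]_m R^o *:%R (dot x) (dotr_is_linear x).

(** * First-order expansions and Frechet differentiability *)

Section Expansion.
Context {R : realType} {m : nat}.
Local Notation V := ('rV[R]_m).
Implicit Types (f : V -> \bar R) (x y z g : V).

Lemma dot_continuous x : continuous (dot x : V -> R).
Proof.
move=> y; apply/(@cvgrPdist_le R R^o V (nbhs y)) => e e0; apply/nearvP.
have M0 : 0 < m.+1%:R * (`|x| + 1) by rewrite mulr_gt0// ltr_pwDr.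
exists (e / (m.+1%:R * (`|x| + 1))); first by rewrite divr_gt0.
move=> z; rewrite ltr_pdivlMr// => /ltW h.
rewrite dotDr opprD addrA subrr add0r normrN (le_trans (dot_norm_le _ _))//.
rewrite (le_trans _ h)// mulrC ler_wpM2l// ler_pM// ?ler_nat//.
by rewrite lerDl.
Qed.

(** Epsilon-delta form of Frechet differentiability, with the gradient as an explicit vector and
    finiteness near [y] built in. *)
Definition expansion f y g := forall e : R, 0 < e -> exists2 d : R, 0 < d &
  forall z, `|z| < d -> f (y + z) \is a fin_num /\
    `|fine (f (y + z)) - fine (f y) - dot g z| <= e * `|z|.

(** Testing at a short multiple of a vector that norms [g] bounds the norm of [g] by every [e]. *)
Lemma small_dot_eq0 g : (forall e : R, 0 < e -> exists2 d : R, 0 < d &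
  forall z, `|z| < d -> dot g z <= e * `|z|) -> g = 0.
Proof.
move=> h; have [u u1 gu] := dot_normer g.
apply/eqP; rewrite -normr_le0; apply/ler_addgt0Pr => e e0; rewrite add0r.
have [d d0 hd] := h _ e0.
have : dot g ((d / 2) *: u) <= e * `|(d / 2) *: u|.
  apply: hd; rewrite normrZ ger0_norm ?divr_ge0 ?ltW//.
  by rewrite (@le_lt_trans _ _ (d / 2))//; [rewrite ler_piMr// divr_ge0 ?ltW|lra].
rewrite normrZ dotZr gu ger0_norm ?divr_ge0 ?(ltW d0)// mulrCA ler_pM2l; last lra.
by move=> /le_trans; apply; rewrite ler_piMr// ltW.
Qed.

Lemma expansion_uniq f y g g' : expansion f y g -> expansion f y g' -> g = g'.
Proof.
move=> h h'; apply/eqP; rewrite -subr_eq0; apply/eqP/small_dot_eq0 => e e0.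
have e20 : 0 < e / 2 by lra.
have [d d0 hd] := h _ e20; have [d' d'0 hd'] := h' _ e20.
exists (Num.min d d'); first by rewrite lt_min d0.
move=> z; rewrite lt_min => /andP[/hd[_ z1] /hd'[_ z2]].
move: z1 z2; rewrite !ler_norml dotBl => /andP[a b] /andP[c d1].
lra.
Qed.

Lemma differentiable_expansion f y : differentiable_at f y ->
  expansion f y (grad f y).
Proof.
move=> df; have [fin dfy] := df; move=> e e0.
have gE z : 'd (fine \o f) y z = dot (grad f y) z.
  rewrite /grad; case: asboolP => // _.
  rewrite {1}(row_sum_delta z) linear_sum; apply: eq_bigr => i _.
  by rewrite linearZ /= mxE deriveE// mulrC.
have := diff_locallyx dfy => dh.
have : \forall z \near (0 : V), `|fine (f (y + z)) - fine (f y) - dot (grad f y) z| <= e * `|z|.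
  have /eqaddoP/(_ e e0) : (fun h => (fine \o f) (h + y)) =
      (fun h => (fine \o f) y + 'd (fine \o f) y h) +o_ (0 : V) id.
    by apply/eqaddoE/funext => z; exact: dh.
  apply: filterS => z /=; rewrite !fctE /= -gE addrC.
  by rewrite [_ + fine _]addrC opprD addrA (addrC z).
move=> /(iffLR (nearvP _ _))[d d0 hd]; move/(iffLR (nearvP _ _)): fin => [d' d'0 hd'].
exists (Num.min d d'); first by rewrite lt_min d0.
move=> z; rewrite lt_min => /andP[/hd + /hd' z2]; rewrite add0r => z1.
by split.
Qed.

Lemma expansion_differentiable f y g : expansion f y g -> differentiable_at f y.
Proof.
move=> h; split.
  by have [d d0 hd] := h _ ltr01; apply/nearvP; exists d => // z /hd[].
have dc : continuous (dot g : V -> R^o) by exact: dot_continuous.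
have key : (fine \o f) \o shift y = cst ((fine \o f) y) + (dot g : V -> R) +o_ (0 : V) id.
  apply/eqaddoP => e e0; have [d d0 hd] := h _ e0.
  apply/nearvP; exists d => // z /hd[_]; rewrite add0r !fctE /= opprD addrA.
  by rewrite (addrC z).
by apply/diff_locallyP; rewrite (diff_unique dc key).
Qed.

Lemma expansionP f y g :
  expansion f y g <-> differentiable_at f y /\ grad f y = g.
Proof.
split=> [h|[d <-]]; last exact: differentiable_expansion.
have d := expansion_differentiable h; split => //.
exact: expansion_uniq (differentiable_expansion d) h.
Qed.

End Expansion.

(** * Lower semicontinuity, growth and conjugation *)

Section LowerSemicontinuous.
Context {R : realType} {m : nat}.
Local Notation V := ('rV[R]_m).
Implicit Types (f G : V -> \bar R) (x y z g : V).

Lemma fin_dom G x : (-oo < G x)%E -> dom G x -> exists a : R, G x = a%:E.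
Proof. by rewrite /dom /=; case: (G x) => // a _ _; exists a. Qed.

Lemma dom_fin G x (a : R) : G x = a%:E -> dom G x.
Proof. by rewrite /dom /= => ->; rewrite ltry. Qed.

Lemma ereal_between (a : R) (u : \bar R) : (a%:E < u)%E ->
  exists2 b : R, a < b & (b%:E < u)%E.
Proof.
case: u => [r| |]//.
- by rewrite lte_fin => ar; exists ((a + r) / 2); rewrite ?lte_fin; lra.
- by move=> _; exists (a + 1); [lra|exact: ltry].
Qed.

(** Covers closed balls ([a = 0]) and spheres ([a = b]) at once. *)
Lemma compact_annulus x (a b : R) :
  compact [set y : V | a <= `|y - x| /\ `|y - x| <= b].
Proof.
have c : continuous (fun y : V => `|y - x| : R^o).
  move=> y; apply/(@cvgrPdist_le R R^o V (nbhs y)) => e e0; apply/nearvP.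
  exists e => // z /ltW; apply: le_trans.
  rewrite (le_trans (ler_dist_dist _ _))// [y + z - x]addrAC opprD addrA subrr.
  by rewrite add0r normrN.
apply: bounded_closed_compact.
  exists (b + `|x|); split; first exact: num_real.
  move=> M bM y [_ yb] /=; rewrite -[y](subrK x) (le_trans (ler_normD _ _))//.
  by rewrite (le_trans _ (ltW bM))// lerD2r.
apply: closedI.
  by apply: (@closed_comp _ _ _ [set r : R^o | a <= r]) => [y _|]; [exact: c|exact: closed_ge].
by apply: (@closed_comp _ _ _ [set r : R^o | r <= b]) => [y _|]; [exact: c|exact: closed_le].
Qed.

(** Lower semicontinuity gives a margin near each point; the near-covering form of compactness makes
    it uniform. *)
Lemma lsc_compact_gap f (K : set V) (c : R) : lower_semicontinuous f ->
  compact K -> (forall x, K x -> (c%:E < f x)%E) ->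
  exists2 d : R, 0 < d & forall x, K x -> ((c + d)%:E <= f x)%E.
Proof.
move=> lf /compact_near_coveringP cK cf.
have : \forall d \near (0 : R)^'+, K `<=` [set x | ((c + d)%:E <= f x)%E].
  apply: (cK R _ (fun d x => ((c + d)%:E <= f x)%E)) => x Kx.
  have [b cb bf] := ereal_between (cf x Kx).
  have [U xU Uf] := lf x b bf.
  exists (U, [set d : R | c + d <= b]).
    split => //=; have cb0 : 0 < b - c by lra.
    by near=> d; rewrite /= -lerBrDl; near: d; exact: nbhs_right_le.
  move=> [x' d] /= [Ux' cd]; apply: le_trans (ltW (Uf _ Ux')).
  by rewrite lee_fin.
move=> h.
have [d [d0 hd]] : exists d : R, 0 < d /\ K `<=` [set x | ((c + d)%:E <= f x)%E].
  near ((0 : R)^'+) => d; exists d; split; first by near: d; exact: nbhs_right_gt.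
  by near: d.
by exists d.
Unshelve. all: by end_near. Qed.

Lemma lsc_compact_bounded f (K : set V) : lower_semicontinuous f ->
  compact K -> (forall x, K x -> (-oo < f x)%E) ->
  exists c : R, forall x, K x -> (c%:E <= f x)%E.
Proof.
move=> lf /compact_near_coveringP cK cf.
have : \forall d \near (pinfty_nbhs R), K `<=` [set x | ((- d)%:E <= f x)%E].
  apply: (cK R _ (fun d x => ((- d)%:E <= f x)%E)) => x Kx.
  have [b bf] : exists b : R, (b%:E < f x)%E.
    move: (cf x Kx); case: (f x) => // [r _|_]; last by exists 0; rewrite ltry.
    by exists (r - 1); rewrite lte_fin; lra.
  have [U xU Uf] := lf x b bf.
  exists (U, [set d : R | - b <= d]).
    by split => //=; apply: nbhs_pinfty_ge; exact: num_real.
  move=> [x' d] /= [Ux' cd]; apply: le_trans (ltW (Uf _ Ux')).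
  by rewrite lee_fin; lra.
move=> h; near (pinfty_nbhs R) => d; exists (- d); near: d.
exact: h.
Unshelve. all: by end_near. Qed.

(** Were the infimum not attained, [f] would exceed it strictly on [K], and the uniform gap would
    raise it. *)
Lemma lsc_compact_min f (K : set V) x1 : lower_semicontinuous f ->
  compact K -> K x1 -> (forall x, K x -> (-oo < f x)%E) ->
  exists2 x0, K x0 & forall x, K x -> (f x0 <= f x)%E.
Proof.
move=> lf cK Kx1 fN.
apply: contrapT => nmin.
have lt_f x : K x -> (ereal_inf (f @` K) < f x)%E.
  move=> Kx; rewrite lt_neqAle ge_ereal_inf ?andbT; last by exists (f x) => //; exists x.
  apply/eqP => fx; apply: nmin; exists x => // z Kz; rewrite -fx.
  by apply: ge_ereal_inf; exists (f z) => //; exists z.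
have [c cf] := lsc_compact_bounded lf cK fN.
have cinf : (c%:E <= ereal_inf (f @` K))%E.
  by apply: le_ereal_inf_tmp => _ [x Kx <-]; exact: cf.
case E : (ereal_inf (f @` K)) cinf lt_f => [r| |]// _ lt_f.
  have [d d0 hd] := lsc_compact_gap lf cK lt_f.
  have : ((r + d)%:E <= ereal_inf (f @` K))%E.
    by apply: le_ereal_inf_tmp => _ [x Kx <-]; exact: hd.
  by rewrite E lee_fin; lra.
by have := lt_f _ Kx1; rewrite ltNge leey.
Qed.

Lemma lsc_coercive_min f x1 (M : R) : lower_semicontinuous f ->
  (forall x, (-oo < f x)%E) -> (forall x, M < `|x - x1| -> (f x1 <= f x)%E) ->
  exists x0, forall x, (f x0 <= f x)%E.
Proof.
move=> lf fN fM.
have [M0|M0] := ltP M 0.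
  by exists x1 => x; apply: fM; exact: lt_le_trans M0 _.
have [||x0 Kx0 h] := @lsc_compact_min f _ x1 lf (@compact_annulus x1 0 M).
- by split; rewrite subrr normr0.
- by move=> x _; exact: fN.
exists x0 => x; have [xM|xM] := leP `|x - x1| M; first exact: h.
by apply: le_trans (fM _ xM); apply: h; split; rewrite subrr normr0.
Qed.

(** Compactness gives a positive lower bound on the sphere of radius [e]; convexity along rays from
    [x0], where [f] is nonpositive, extends it linearly outwards. *)
Lemma convex_growth f x0 : convex_ext f -> lower_semicontinuous f ->
  (f x0 <= 0)%E -> (forall x, x != x0 -> (0 < f x)%E) ->
  forall e : R, 0 < e -> exists2 d : R, 0 < d &
    forall x, e <= `|x - x0| -> ((d * `|x - x0|)%:E <= f x)%E.
Proof.
move=> cf lf f0 fpos e e0.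
have xx0 x : e <= `|x - x0| -> x != x0.
  by apply: contraTneq => ->; rewrite subrr normr0 -ltNge.
have [|d d0 hd] := lsc_compact_gap (c := 0) lf (@compact_annulus x0 e e).
  by move=> x [/xx0 /fpos].
exists (d / e); first by rewrite divr_gt0.
move=> x ex; have := fpos _ (xx0 _ ex).
case fx : (f x) => [a| |]//; last by rewrite leey.
rewrite lee_fin lte_fin => a0.
have [xe|xe] := eqVneq `|x - x0| e.
  rewrite xe divfK ?gt_eqF//.
  by have := hd x; rewrite add0r fx lee_fin; apply; rewrite /= xe.
have lt_ex : e < `|x - x0| by rewrite lt_neqAle eq_sym xe.
(* The weight that brings [x] onto the sphere of radius [e]. *)
pose t := e / `|x - x0|.
have r0 : 0 < `|x - x0| by lra.
have t0 : 0 < t by rewrite divr_gt0.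
have t1 : t < 1 by rewrite ltr_pdivrMr// mul1r.
have zE : t *: x + (1 - t) *: x0 - x0 = t *: (x - x0).
  by rewrite scalerBl scale1r addrA addrAC addrK scalerBr.
have nz : `|t *: x + (1 - t) *: x0 - x0| = e.
  by rewrite zE normrZ gtr0_norm// divfK ?gt_eqF.
have := hd (t *: x + (1 - t) *: x0); rewrite add0r /= nz => /(_ (conj _ _)).
move=> /(_ (lexx _) (lexx _)) /le_trans /(_ (cf _ _ _ t0 t1)).
have : ((1 - t)%:E * f x0 <= 0)%E by rewrite mule_ge0_le0// lee_fin; lra.
move=> h1 /le_trans /(_ (leeD2l _ h1)); rewrite adde0 fx -EFinM lee_fin.
by rewrite /t mulrAC ler_pdivlMr// mulrAC ler_pdivrMr// (mulrC a).
Qed.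

(** Minimising this function maximises [<., y> - G]. With [c] the value of the conjugate at [y] it
    is the gap in the Fenchel-Young inequality. *)
Definition tilt G y (c : R) : V -> \bar R := fun x => (G x + (c - dot x y)%:E)%E.

Lemma tilt_lsc G y c : lower_semicontinuous G -> lower_semicontinuous (tilt G y c).
Proof.
move=> lG x a; rewrite /tilt -lteBlDr// -EFinB => /ereal_between[b ab bG].
have [U xU UG] := lG _ _ bG.
have b0 : 0 < b - (a - (c - dot x y)) by lra.
exists (U `&` [set x' | a - (c - dot x' y) < b]).
  apply: filterI => //.
  have := @dot_continuous R m y x.
  move=> /(@cvgrPdist_lt R R^o V (nbhs x))/(_ _ b0); apply: filterS => x' /=.
  by rewrite !(dotC y) ltr_norml => /andP[h1 h2]; lra.
by move=> x' [Ux' h]; rewrite -lteBlDr// -EFinB (lt_trans _ (UG _ Ux')).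
Qed.

Lemma tilt_convex G y c : (forall x, (-oo < G x)%E) -> convex_ext G ->
  convex_ext (tilt G y c).
Proof.
move=> GN cG x z t t0 t1; rewrite /tilt.
have t1' : 0 < 1 - t by lra.
case Gx : (G x) (GN x) => [a| |]// _; last first.
  rewrite addye// gt0_muley ?lte_fin// addye ?leey// gt_eqF//.
  case: (G z) (GN z) => [b| |]// _; first by rewrite -EFinD -EFinM ltNyr.
  by rewrite addye// gt0_muley ?lte_fin.
case Gz : (G z) (GN z) => [b| |]// _; last first.
  by rewrite addye// gt0_muley ?lte_fin// addey ?leey// -EFinD -EFinM.
have := cG x z t t0 t1; rewrite Gx Gz -!EFinM -!EFinD => h.
apply: (le_trans (leeD2r _ h)); rewrite -EFinD lee_fin !dotE; lra.
Qed.

End LowerSemicontinuous.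

(** * Conjugates, subgradients and strong maximisers *)

Section Conjugate.
Context {R : realType} {m : nat}.
Local Notation V := ('rV[R]_m).
Implicit Types (f G : V -> \bar R) (x y z g : V).

Lemma conj_ge G x y (a : R) : G x = a%:E -> ((dot x y - a)%:E <= conjugate G y)%E.
Proof.
move=> Gx; apply: ereal_sup_ubound; exists x; last by rewrite Gx.
exact: dom_fin Gx.
Qed.

Lemma young G x y (a b : R) : G x = a%:E -> conjugate G y = b%:E ->
  dot x y <= a + b.
Proof. by move=> /(conj_ge y) + Gy; rewrite Gy lee_fin; lra. Qed.

Lemma conj_le G y (b : R) : (forall x, (-oo < G x)%E) ->
  (forall x a, G x = a%:E -> dot x y - a <= b) -> (conjugate G y <= b%:E)%E.
Proof.
move=> GN h; apply: ge_ereal_sup => _ [x /(fin_dom (GN x))[a Ga] <-].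
by rewrite Ga -EFinB lee_fin; exact: h.
Qed.

Lemma conj_gtNy G y : proper_fun G -> (-oo < conjugate G y)%E.
Proof.
move=> [GN [x /(fin_dom (GN x))[a Ga]]].
by apply: lt_le_trans (conj_ge y Ga); rewrite ltNyr.
Qed.

Lemma expansion_fin f y g : expansion f y g -> exists b : R, f y = b%:E.
Proof.
move=> /(_ _ ltr01)[d d0 /(_ 0)]; rewrite normr0 => /(_ d0)[+ _].
by rewrite addr0; case: (f y) => // r _; exists r.
Qed.

(** Comparing the subgradient inequality with the expansion gives [dot (x - g) z <= e * |z|] for
    small [z]. *)
Lemma expansion_subgrad f y g x (b : R) : expansion f y g -> f y = b%:E ->
  (forall y', ((b + dot x (y' - y))%:E <= f y')%E) -> x = g.
Proof.
move=> h fy sub; apply/eqP; rewrite -subr_eq0; apply/eqP/small_dot_eq0 => e e0.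
have [d d0 hd] := h e e0; exists d => // z /hd[fz]; rewrite fy/=.
have := sub (y + z); rewrite addrAC subrr add0r -{1}(fineK fz) lee_fin dotBl.
by rewrite ler_norml => h1 /andP[_ h2]; lra.
Qed.

Lemma expansion_ub f y g (b e : R) : expansion f y g -> f y = b%:E -> 0 < e ->
  exists2 d : R, 0 < d & forall z, `|z| < d ->
    (f (y + z)%R <= (b + dot g z + e * `|z|)%:E)%E.
Proof.
move=> h fy e0; have [d d0 hd] := h e e0; exists d => // z /hd[fz].
rewrite fy/= -{2}(fineK fz) lee_fin ler_norml => /andP[_ h2]; lra.
Qed.

(** The last hypothesis makes [x0] a strong maximiser of [<., y> - G]. For small [z], points far
    from [x0] lose more by this growth than they gain from [z], and near points change the supremum
    by at most [e * |z|]. *)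
Lemma conj_expansion G y x0 (b : R) : (forall x, (-oo < G x)%E) ->
  conjugate G y = b%:E ->
  (forall y', ((b + dot x0 (y' - y))%:E <= conjugate G y')%E) ->
  (forall e : R, 0 < e -> exists2 d : R, 0 < d & forall x a, G x = a%:E ->
     e <= `|x - x0| -> d * `|x - x0| <= a - dot x y + b) ->
  expansion (conjugate G) y x0.
Proof.
move=> GN Gy sub gr e e0.
pose M : R := m.+1%:R; have M0 : 0 < M by [].
have eM0 : 0 < e / M by rewrite divr_gt0.
have [d d0 hd] := gr _ eM0.
exists (d / M); first by rewrite divr_gt0.
move=> z zd.
have ub : (conjugate G (y + z)%R <= (b + dot x0 z + e * `|z|)%:E)%E.
  apply: conj_le => // x a Gx.
  have yg := young Gx Gy.
  have xz : dot (x - x0) z <= M * `|x - x0| * `|z| by exact: dot_le.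
  rewrite dotDr; move: xz; rewrite dotBl => xz.
  have ez : 0 <= e * `|z| by rewrite mulr_ge0// ltW.
  have [ex|xe] := leP (e / M) `|x - x0|.
    have h1 := hd _ _ Gx ex.
    have : M * `|x - x0| * `|z| <= d * `|x - x0|.
      rewrite mulrAC ler_wpM2r// mulrC -ler_pdivlMr// ltW//.
    lra.
  have : M * `|x - x0| * `|z| <= e * `|z|.
    by rewrite ler_wpM2r// mulrC -ler_pdivlMr// ltW.
  lra.
have := sub (y + z); rewrite addrAC subrr add0r.
move: ub; case: (conjugate G (y + z)) => [r| |]//; rewrite !lee_fin Gy /= => h1 h2.
by split => //; rewrite ler_norml; apply/andP; split; nra.
Qed.

(* Smulian's argument: an almost maximizer of <., y> - G is an almost
   subgradient of the conjugate, hence close to g. *)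
Lemma conj_attained G y g (b : R) : (forall x, (-oo < G x)%E) ->
  lower_semicontinuous G -> expansion (conjugate G) y g ->
  conjugate G y = b%:E -> G g = (dot g y - b)%:E.
Proof.
move=> GN lG ex Gy.
have ge : ((dot g y - b)%:E <= G g)%E.
  case Gg : (G g) (GN g) => [a| |]// _; last by rewrite leey.
  by have := young Gg Gy; rewrite lee_fin; lra.
apply/eqP; rewrite eq_le ge andbT leNgt; apply/negP => lt.
(* If [G g] were larger, the gap would be positive at [g], hence above some [eta] on a ball of
   radius [e] around it. *)
have : (0%:E < tilt G y b g)%E.
  by rewrite /tilt; move: lt; case: (G g) => [a| |]//; rewrite ?ltry// !lte_fin; lra.
move=> /ereal_between[eta eta0] /(tilt_lsc lG)[U /nearvP[e e0 hU] Ueta].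
have e20 : 0 < e / 2 by lra.
have [d d0 hd] := expansion_ub ex Gy e20.
pose t := d / 2; have t0 : 0 < t by rewrite /t; lra.
(* Every point would then miss the supremum by [k]: by [eta] inside the ball, by [t * (e / 2)]
   outside. *)
pose k := Num.min eta (t * (e / 2)).
have k0 : 0 < k by rewrite lt_min eta0 mulr_gt0.
suff : (conjugate G y <= (b - k)%:E)%E by rewrite Gy lee_fin; lra.
apply: conj_le => // x a Gx.
have [xe|xe] := ltP `|x - g| e.
  have : (eta%:E < tilt G y b x)%E.
    by apply: Ueta; rewrite -(subrKC g x); exact: hU.
  rewrite /tilt Gx lte_fin => h1.
  have : k <= eta by rewrite ge_min lexx.
  lra.
(* Outside the ball, the expansion of the conjugate is tested in a direction that norms [x - g]. *)
have [u u1 xu] := dot_normer (x - g).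
have tu : `|t *: u| <= t by rewrite normrZ gtr0_norm// ler_piMr// ltW.
have tud : `|t *: u| < d by rewrite (le_lt_trans tu)// /t; lra.
have := conj_ge (y + t *: u)%R Gx => /le_trans/(_ (hd _ tud)).
rewrite lee_fin !dotE => h1.
have h2 : e / 2 * `|t *: u| <= t * (e / 2) by rewrite mulrC ler_wpM2r// ltW.
have h3 : k <= t * (e / 2) by rewrite ge_min lexx orbT.
have h4 : t * e <= t * `|x - g| by rewrite ler_wpM2l// ltW.
move: xu; rewrite dotBl => xu.
have h5 : t * dot x u - t * dot g u = t * `|x - g| by rewrite -mulrBr xu.
lra.
Qed.

End Conjugate.

(** * Gradients and subgradients of convex functions *)

Section Convex.
Context {R : realType} {m : nat}.
Local Notation V := ('rV[R]_m).
Implicit Types (f G : V -> \bar R) (x y z g : V).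

Lemma convex_subgrad f x g (a : R) : (forall x, (-oo < f x)%E) ->
  convex_ext f -> expansion f x g -> f x = a%:E ->
  forall z, ((a + dot g (z - x))%:E <= f z)%E.
Proof.
move=> fN cf ex fx z; case fz : (f z) (fN z) => [b| |]// _; last by rewrite leey.
rewrite lee_fin -lerBrDl; apply/ler_addgt0Pr => e e0.
(* The summand 1 keeps the denominator positive when [z = x]; the scaled accuracy makes the error at
   [x + t *: w] at most [t * e]. *)
pose w := z - x; have w0 : 0 < `|w| + 1 by rewrite ltr_pwDr.
have e10 : 0 < e / (`|w| + 1) by rewrite divr_gt0.
have [d d0 hd] := ex _ e10.
pose t := Num.min (2^-1) (d / (`|w| + 1) / 2).
have t0 : 0 < t by rewrite lt_min invr_gt0 ltr0n !divr_gt0.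
have t1 : t < 1 by rewrite gt_min invf_lt1// ltr1n.
have tw : `|t *: w| < d.
  rewrite normrZ gtr0_norm// (@le_lt_trans _ _ (t * (`|w| + 1)))//.
    by rewrite ler_wpM2l ?(ltW t0)// lerDl.
  rewrite -ltr_pdivlMr// gt_min; apply/orP; right.
  by rewrite gtr_pMr ?divr_gt0// invf_lt1// ltr1n.
have [fxw] := hd _ tw; have := cf z x t t0 t1.
have -> : t *: z + (1 - t) *: x = x + t *: w.
  by rewrite scalerBl scale1r scalerBr addrCA.
rewrite fz fx -(fineK fxw) -!EFinM -!EFinD lee_fin /= => h1.
rewrite ler_norml => /andP[h2 _]; move: h2.
rewrite normrZ gtr0_norm// dotZr => h2.
have h3 : e / (`|w| + 1) * (t * `|w|) <= t * e.
  rewrite mulrCA ler_wpM2l ?(ltW t0)// mulrAC ler_pdivrMr// ler_wpM2l ?(ltW e0)//.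
  by rewrite lerDl.
have : t * dot g w <= t * (b - a + e) by lra.
by rewrite ler_pM2l.
Qed.

(** The ball of radius [(1 - t) * r] around [t *: x] consists of convex combinations of [x] and
    points of the ball around 0. *)
Lemma interior_segment f x (r t : R) : (forall x, (-oo < f x)%E) ->
  convex_ext f -> dom f x -> (forall z, `|z| < r -> dom f z) -> 0 < r ->
  0 <= t -> t < 1 -> (dom f)° (t *: x).
Proof.
move=> fN cf fx fr r0; rewrite le_eqVlt => /predU1P[<- _|t0 t1].
  by rewrite scale0r; apply/nearvP; exists r => // z; rewrite add0r => /fr.
have t1' : 0 < 1 - t by lra.
apply/nearvP; exists ((1 - t) * r); first by rewrite mulr_gt0.
move=> z zr.
have dz : dom f ((1 - t)^-1 *: z).
  by apply: fr; rewrite normrZ gtr0_norm ?invr_gt0// mulrC ltr_pdivrMr// mulrC.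
have -> : t *: x + z = t *: x + (1 - t) *: ((1 - t)^-1 *: z).
  by rewrite scalerA divff ?gt_eqF// scale1r.
have [a fxa] := fin_dom (fN _) fx; have [b fzb] := fin_dom (fN _) dz.
apply: (le_lt_trans (cf _ _ _ t0 t1)).
by rewrite fxa fzb -!EFinM -EFinD ltry.
Qed.

(* The gradients along the segment from 0 to a point where f has a subgradient
   stay bounded, so that point cannot lie on the boundary. *)
Lemma essentially_smooth_subdiff f x y : (forall x, (-oo < f x)%E) ->
  convex_ext f -> essentially_smooth f -> (dom f)° 0 ->
  subdifferential f x y -> (dom f)° x.
Proof.
move=> fN cf [_ df blow] f0 [dx sub].
have [a fx] := fin_dom (fN _) dx.
have e0 := differentiable_expansion (df _ f0).
have [c0 f0c] := expansion_fin e0.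
have [r r0 hr] := expansion_ub e0 f0c ltr01.
pose C := c0 + m.+1%:R * `|grad f 0| * r + r.
have fr z : `|z| < r -> (f z <= C%:E)%E.
  move=> zr; have := hr _ zr; rewrite add0r => /le_trans; apply.
  rewrite lee_fin /C -!addrA lerD2l lerD//; last by rewrite mul1r ltW.
  by rewrite (le_trans (dot_le _ _))// ler_wpM2l ?mulr_ge0// ltW.
apply: contrapT => nx.
pose t n : R := 1 - harmonic n.
have t01 n : 0 <= t n < 1.
  by rewrite /t subr_ge0 invf_le1// ler1n/= ltrBlDr ltrDl invr_gt0.
have tx n : (dom f)° (t n *: x).
  have /andP[t0 t1] := t01 n.
  apply: (@interior_segment f x r (t n)) => //.
  by move=> z /fr h; rewrite /dom /= (le_lt_trans h)// ltry.
have cvg_t : (fun n => t n *: x) @ \oo --> x.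
  rewrite -[X in _ --> X]scale1r; apply: cvgZ; last exact: cvg_cst.
  by rewrite -[X in _ --> X]subr0; apply: cvgB; [exact: cvg_cst|exact: cvg_harmonic].
have := blow _ _ tx cvg_t nx.
(* On the boundary some gradient would exceed this threshold; [h1], [h2] and [h3] show that none
   does. *)
move=> /cvgryPgt /(_ ((C - a + dot y x) / (r / 2))) [N _ /(_ N (leqnn _))] /=.
apply/negP; rewrite -leNgt ler_pdivlMr; last by lra.
set u := t N *: x; set g := grad f u.
have eu : expansion f u g := differentiable_expansion (df _ (tx N)).
have [b fu] := expansion_fin eu.
have sg := convex_subgrad fN cf eu fu.
have [w w1 gw] := dot_normer g.
have /andP[t0 t1] := t01 N.
(* The gradient inequality at [u] is tested in the ball along a direction norming [g], then at [x];
   the subgradient inequality at [x] is tested at [u]. *)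
have h1 : b + dot g ((r / 2) *: w - u) <= C.
  rewrite -lee_fin (le_trans (sg _))// fr// normrZ gtr0_norm; last by lra.
  by rewrite (@le_lt_trans _ _ (r / 2))//; [rewrite ler_piMr//; lra|lra].
have h2 : b + dot g (x - u) <= a by have := sg x; rewrite fx lee_fin.
have h3 : a + dot y (u - x) <= b.
  by have := sub u; rewrite fx fu -EFinD lee_fin.
move: h1 h2 h3; rewrite /u !dotE gw => h1 h2 h3.
have h4 : (1 - t N) * dot g x <= (1 - t N) * dot y x by lra.
have h5 : dot g x <= dot y x by move: h4; rewrite ler_pM2l//; lra.
have : t N * dot g x <= t N * dot y x by rewrite ler_wpM2l.
lra.
Qed.

End Convex.

(** * Legendre duality for energy functions *)

Section ConvexSets.
Context {R : realType} {m : nat}.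
Local Notation V := ('rV[R]_m).

Lemma convex_setP (C : set V) : convex_set C <->
  forall x y (t : R), C x -> C y -> 0 < t -> t < 1 -> C (t *: x + (1 - t) *: y).
Proof.
split=> [cC x y t Cx Cy t0 t1|cC].
  have := cC x y (Itv01 (ltW t0) (ltW t1)).
  by move/(_ (mem_set Cx) (mem_set Cy)) => /set_mem.
apply/convex_setW => x y /set_mem Cx /set_mem Cy k k0 k1.
by apply/mem_set; exact: cC.
Qed.

End ConvexSets.

(** * Maximisers and regularity of the conjugate *)

Section LegendreConjugate.
Context {R : realType} {m : nat}.
Local Notation V := ('rV[R]_m).
Implicit Types (f G : V -> \bar R) (x y z g : V).

(** [a + b = dot x y] is the equality case of Fenchel-Young: [x] attains the supremum at [y]. The
    same [x] competes at every [y']. *)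
Lemma conj_attained_sub f x y (a b : R) : f x = a%:E -> a + b = dot x y ->
  forall y', ((b + dot x (y' - y))%:E <= conjugate f y')%E.
Proof.
move=> fx ab y'; apply: le_trans (conj_ge y' fx).
by rewrite lee_fin dotBr -ab; lra.
Qed.

Lemma attained_subdifferential f x y (a b : R) : (forall x, (-oo < f x)%E) ->
  conjugate f y = b%:E -> f x = a%:E -> a + b = dot x y ->
  subdifferential f x y.
Proof.
move=> fN fy fx ab; split; first exact: dom_fin fx.
move=> z; case fz : (f z) (fN z) => [c| |]// _; last by rewrite leey.
have := young fz fy; rewrite fx -EFinD lee_fin dotBr !(dotC y); lra.
Qed.

(** The maximisers form a convex set on which [y] is a subgradient, so strict convexity applies
    there; the midpoint of two of them would exceed the supremum. *)
Lemma maximizer_uniq f x x' y (a a' b : R) : essentially_strictly_convex f ->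
  convex_ext f -> (forall x, (-oo < f x)%E) -> conjugate f y = b%:E ->
  f x = a%:E -> f x' = a'%:E -> a + b = dot x y -> a' + b = dot x' y -> x = x'.
Proof.
move=> sc cf fN fy fx fx' xy x'y.
pose C := [set z | f z = (dot z y - b)%:E].
have ge z : ((dot z y - b)%:E <= f z)%E.
  case fz : (f z) (fN z) => [c| |]// _; last by rewrite leey.
  by have := young fz fy; rewrite lee_fin; lra.
have Cx : C x by rewrite /C /= fx; congr (_%:E); lra.
have Cx' : C x' by rewrite /C /= fx'; congr (_%:E); lra.
apply/eqP/negPn/negP => xx'.
have cC : convex_set C.
  apply/convex_setP => u v t; rewrite /C /= => fu fv t0 t1.
  apply/eqP; rewrite eq_le ge andbT (le_trans (cf _ _ _ t0 t1))//.
  by rewrite fu fv -!EFinM -EFinD lee_fin !dotE; lra.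
have sC : C `<=` [set z | subdifferential f z !=set0].
  move=> z fz; exists y; apply: (attained_subdifferential fN fy fz); lra.
have h0 : (0 : R) < 2^-1 by lra.
have h1 : (2^-1 : R) < 1 by lra.
have := sc C sC cC x x' _ Cx Cx' xx' h0 h1.
rewrite Cx Cx' => h; have := le_lt_trans (ge _) h.
by rewrite -!EFinM -EFinD lte_fin !dotE; lra.
Qed.

(** By uniqueness the gap vanishes only at [x0], so [convex_growth] makes [x0] a strong
    maximiser. *)
Lemma attained_expansion f x0 y (a b : R) : (forall x, (-oo < f x)%E) ->
  lower_semicontinuous f -> convex_ext f -> essentially_strictly_convex f ->
  conjugate f y = b%:E -> f x0 = a%:E -> a + b = dot x0 y ->
  expansion (conjugate f) y x0.
Proof.
move=> fN lf cf sc fy fx0 ab.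
apply: conj_expansion => //; first exact: fy.
  exact: conj_attained_sub fx0 ab.
have t0 : (tilt f y b x0 <= 0)%E by rewrite /tilt fx0 -EFinD lee_fin; lra.
have tpos x : x != x0 -> (0 < tilt f y b x)%E.
  move=> xx0; rewrite /tilt; case fx : (f x) (fN x) => [c| |]// _; last by rewrite addye// ltry.
  rewrite -EFinD lte_fin lt_neqAle.
  have := young fx fy => yg; apply/andP; split; last lra.
  apply: contra xx0 => /eqP h; apply/eqP.
  by apply: (maximizer_uniq sc cf fN fy fx fx0 _ ab); lra.
move=> e /(convex_growth (tilt_convex y b fN cf) (tilt_lsc (y:=y) (c:=b) lf) t0 tpos)[d d0 hd].
exists d => // x c fx /hd; rewrite /tilt fx -EFinD lee_fin; lra.
Qed.

(** Each finite value of the conjugate at a point [y] plus or minus [d / 2] times a basis vector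
    bounds one signed coordinate of [x]; together they bound the sup norm. *)
Lemma conj_linear_growth f y : proper_fun f -> (dom (conjugate f))° y ->
  exists2 r : R, 0 < r & exists C : R, forall x a, f x = a%:E ->
    r * `|x| <= a - dot x y + C.
Proof.
move=> pf /nearvP[d d0 hd].
pose p (ib : 'I_m * bool) : V := y + (d / 2 * (-1) ^+ ib.2) *: delta_mx 0 ib.1.
have d20 : 0 < d / 2 by lra.
have pfin ib : exists c : R, conjugate f (p ib) = c%:E.
  apply: fin_dom; first exact: conj_gtNy.
  apply: hd; rewrite normrZ normrM normr_sign mulr1 gtr0_norm//.
  by rewrite (@le_lt_trans _ _ (d / 2))//; [rewrite ler_piMr ?norm_delta// ltW|lra].
have [c hc] := choice pfin.
have [b fy] : exists b : R, conjugate f y = b%:E.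
  apply: fin_dom; first exact: conj_gtNy.
  by rewrite -[y]addr0; apply: hd; rewrite normr0.
(* The term in [b] serves [x = 0]; the sum dominates every [c ib]. *)
pose C : R := `|b| + \sum_ib `|c ib|.
have s0 : 0 <= \sum_ib `|c ib| by rewrite sumr_ge0.
exists (d / 2) => //; exists C => x a fx.
have [x0|x0] := eqVneq x 0.
  move: fx; rewrite x0 normr0 mulr0 dot0l /C => fx.
  have := young fx fy; have := ler_norm b; rewrite dot0l; lra.
have dp (ib : 'I_m * bool) : d / 2 * (-1) ^+ ib.2 * x 0 ib.1 <= a - dot x y + C.
  have := conj_ge (p ib) fx; rewrite hc lee_fin /p !dotE dot_delta => h.
  have : c ib <= \sum_ib `|c ib|.
    by rewrite (bigD1 ib)//= (le_trans (ler_norm _))// lerDl sumr_ge0.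
  have : 0 <= `|b| by [].
  rewrite /C; lra.
have [|[j i]] := @mx_norm_neq0 R 1 m x.
  by rewrite (_ : mx_norm x = `|x|)// normr_eq0.
rewrite [X in X = _ -> _](_ : _ = `|x|)// ord1 /= => ->.
(* The boolean selects the sign of the coordinate that realises the norm. *)
have := dp (i, x 0 i < 0) => /=; rewrite -mulrA.
by rewrite -normrEsign.
Qed.

Lemma conj_maximizer f y : proper_fun f -> lower_semicontinuous f ->
  (dom (conjugate f))° y -> exists x0 a b,
  [/\ f x0 = a%:E, conjugate f y = b%:E & a + b = dot x0 y].
Proof.
move=> pf lf iy; have [fN [x1 /(fin_dom (fN _))[a1 fx1]]] := pf.
have [r r0 [C hC]] := conj_linear_growth pf iy.
have dy : dom (conjugate f) y := nbhs_singleton iy.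
have [b fy] := fin_dom (conj_gtNy y pf) dy.
(* Beyond this radius around [x1], linear growth exceeds the value of the tilted function at
   [x1]. *)
have [|x|x0 x0min] := @lsc_coercive_min R m (tilt f y 0) x1
    (`|x1| + (a1 - dot x1 y + C) / r) (tilt_lsc lf).
- by move=> x; rewrite /tilt; case: (f x) (fN x) => [c| |]//; rewrite ?ltNyr.
- move=> xM; rewrite /tilt; case fx : (f x) (fN x) => [c| |]// _; last first.
    by rewrite addye// leey.
  rewrite fx1 -!EFinD lee_fin.
  have h1 : (a1 - dot x1 y + C) / r < `|x|.
    by have := ler_normB x x1; lra.
  have := hC _ _ fx; move: h1; rewrite ltr_pdivrMr// mulrC; lra.
have := x0min x1; rewrite /tilt fx1.
case fx0 : (f x0) (fN x0) => [a| |]// _ _.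
exists x0, a, b; split => //.
apply/eqP; rewrite eq_le (young fx0 fy) andbT.
suff : (conjugate f y <= (dot x0 y - a)%:E)%E by rewrite fy lee_fin; lra.
apply: conj_le => // x c fx.
have := x0min x; rewrite /tilt fx0 fx -!EFinD lee_fin; lra.
Qed.

(** An affine function in the supremum that exceeds [a] at [y] does so near [y]; a value [-oo] of
    [f] makes the conjugate [+oo] everywhere. *)
Lemma conj_lsc f : lower_semicontinuous (conjugate f).
Proof.
move=> y a; rewrite ltNge => /negP h.
have [x [dx hx]] : exists x, dom f x /\ (a%:E < (dot x y)%:E - f x)%E.
  apply: contrapT => nx; apply: h; apply: ge_ereal_sup => _ [x dx <-].
  by rewrite leNgt; apply/negP => hx; apply: nx; exists x.
have ub y' : (((dot x y')%:E - f x) <= conjugate f y')%E.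
  by apply: ereal_sup_ubound; exists x.
case fx : (f x) hx ub dx => [c| |]; rewrite /dom /= fx //; last first.
  move=> _ ub _; exists setT; first exact: filterT.
  by move=> y' _; apply: lt_le_trans (ub y'); rewrite /= ltry.
rewrite -EFinB lte_fin => hx ub _.
have e0 : 0 < dot x y - c - a by lra.
exists [set y' | a < dot x y' - c].
  have := @dot_continuous R m x y.
  move=> /(@cvgrPdist_lt R R^o V (nbhs y))/(_ _ e0); apply: filterS => y' /=.
  by rewrite ltr_norml => /andP[h1 h2]; lra.
by move=> y' /= hy'; apply: lt_le_trans (ub y'); rewrite lte_fin.
Qed.

Lemma conj_convex f : proper_fun f -> convex_ext (conjugate f).
Proof.
move=> pf y z t t0 t1; have t1' : 0 < 1 - t by lra.
have [fN _] := pf.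
case fy : (conjugate f y) (conj_gtNy y pf) => [b| |]// _; last first.
  rewrite gt0_muley ?lte_fin// addye ?leey// gt_eqF//.
  case: (conjugate f z) (conj_gtNy z pf) => [c| |]// _; first by rewrite -EFinM ltNyr.
  by rewrite gt0_muley ?lte_fin.
case fz : (conjugate f z) (conj_gtNy z pf) => [c| |]// _; last first.
  by rewrite gt0_muley ?lte_fin// addey ?leey// -EFinM.
rewrite -!EFinM -EFinD; apply: conj_le => // x a fx.
have h1 : t * dot x y <= t * (a + b) by rewrite ler_pM2l// (young fx fy).
have h2 : (1 - t) * dot x z <= (1 - t) * (a + c) by rewrite ler_pM2l// (young fx fz).
rewrite !dotE; lra.
Qed.

End LegendreConjugate.

(** * Energy functions and the Legendre property of their conjugates *)

Section Energy.
Context {R : realType} {m : nat}.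
Local Notation V := ('rV[R]_m).
Implicit Types (f G : V -> \bar R) (x y z g : V) (N : V -> R).

Lemma radial_opp f x : radial f -> f (- x) = f x.
Proof.
move=> [N [fo [[_ NZ _] fE]]].
by rewrite !fE -scaleN1r NZ normrN1 mul1r.
Qed.

(** A radial function is even, and [z] is the midpoint of [x + z] and [- (x - z)]: a ball around [x]
    and its reflection average to a ball around 0. *)
Lemma radial_interior0 f : (forall x, (-oo < f x)%E) -> convex_ext f ->
  radial f -> (dom f)° !=set0 -> (dom f)° 0.
Proof.
move=> fN cf rf [x /nearvP[d d0 hd]]; apply/nearvP; exists d => // z zd.
rewrite add0r.
have [a fa] := fin_dom (fN _) (hd z zd).
have zd' : `|- z| < d by rewrite normrN.
have [b fb] := fin_dom (fN _) (hd _ zd').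
have -> : z = 2^-1 *: (x + z) + (1 - 2^-1) *: (- (x - z)).
  have -> : 1 - 2^-1 = 2^-1 :> R by lra.
  rewrite -scalerDr opprB [x + z]addrC addrACA subrr addr0 -mulr2n -[z *+ 2]scaler_nat scalerA.
  by rewrite mulVf ?scale1r.
have h0 : (0 : R) < 2^-1 by lra.
have h1 : (2^-1 : R) < 1 by lra.
apply: (le_lt_trans (cf _ _ _ h0 h1)).
by rewrite radial_opp// fa fb -!EFinM -EFinD ltry.
Qed.

Lemma energy_interior0 f : energy f -> (dom f)° 0.
Proof. by move=> [[[fN _] _ cf [i0 _ _] _] _ rf]; exact: radial_interior0. Qed.

Lemma energy_expansion0 f : energy f -> exists a : R, f 0 = a%:E /\ expansion f 0 0.
Proof.
move=> ef; have i0 := energy_interior0 ef.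
have [[[fN _] _ _ [_ df _] _] minf _] := ef.
have ex := differentiable_expansion (df _ i0).
have [a f0] := expansion_fin ex; exists a; split => //.
rewrite [X in expansion _ _ X](_ : _ = grad f 0)//.
apply: (expansion_subgrad ex f0) => y; rewrite dot0l addr0 -f0.
by have [->//|/minf/ltW] := eqVneq y 0.
Qed.

Lemma conj0 f (a : R) : energy f -> f 0 = a%:E -> conjugate f 0 = (- a)%:E.
Proof.
move=> [[[fN _] _ _ _ _] minf _] f0; apply/eqP; rewrite eq_le; apply/andP; split.
  apply: conj_le => // x c fx; rewrite dot0r sub0r lerN2 -lee_fin -f0 -fx.
  by have [->//|/minf/ltW] := eqVneq x 0.
by have := conj_ge 0 f0; rewrite dot0r sub0r.
Qed.

Lemma conj_interior0 f : energy f -> (dom (conjugate f))° 0.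
Proof.
move=> ef; have [a [f0 _]] := energy_expansion0 ef.
have [[[fN _] lf cf _ sc] _ _] := ef.
have ex : expansion (conjugate f) 0 0.
  by apply: (attained_expansion fN lf cf sc (conj0 ef f0) f0); rewrite dot0r subrr.
have [d d0 hd] := expansion_ub ex (conj0 ef f0) ltr01.
by apply/nearvP; exists d => // z /hd h; rewrite /dom /= (le_lt_trans h) ?ltry.
Qed.

(** Along [t *: y] the function [f] rises only by a small fraction of [t], since its gradient at 0
    is 0, whereas the pairing with [y] is linear in [t]. *)
Lemma conj_min f y : energy f -> y != 0 -> (conjugate f 0%R < conjugate f y)%E.
Proof.
move=> ef y0; have [a [f0 ex]] := energy_expansion0 ef.
rewrite (conj0 ef f0).
have yy : 0 < dot y y.
  by rewrite ltNge; apply: contra y0 => /dotxx_le0 ->.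
have ny : 0 < `|y| by rewrite normr_gt0.
(* This accuracy makes the error at [t *: y] exactly half of [t * dot y y]. *)
have e0 : 0 < dot y y / (2 * `|y|) by rewrite divr_gt0// mulr_gt0.
have [d d0 hd] := expansion_ub ex f0 e0.
pose t := d / (2 * `|y|); have t0 : 0 < t by rewrite divr_gt0// mulr_gt0.
have td : `|t *: y| < d.
  rewrite normrZ gtr0_norm// (_ : t * `|y| = d / 2); last by rewrite /t; field; exact: lt0r_neq0.
  lra.
have := hd _ td; rewrite add0r dot0l addr0.
have [[[fN _] _ _ _ _] _ _] := ef.
case ft : (f (t *: y)) (fN (t *: y)) => [c| |]// _; rewrite lee_fin => h.
apply: lt_le_trans (conj_ge y ft); rewrite lte_fin dotZl.
have : dot y y / (2 * `|y|) * `|t *: y| = t * dot y y / 2.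
  by rewrite normrZ gtr0_norm//; field; exact: lt0r_neq0.
have : 0 < t * dot y y by rewrite mulr_gt0.
lra.
Qed.

(** An attained supremum makes the conjugate differentiable at [y], hence finite near [y]. *)
Lemma maximizer_interior f x y (a b : R) : legendre f ->
  conjugate f y = b%:E -> f x = a%:E -> a + b = dot x y ->
  (dom (conjugate f))° y.
Proof.
move=> [[fN _] lf cf _ sc] fy fx ab.
have [+ _] := expansion_differentiable (attained_expansion fN lf cf sc fy fx ab).
by apply: filterS => z; rewrite /dom /= fin_numElt => /andP[].
Qed.

Lemma conj_interior_attained f y : legendre f -> (dom (conjugate f))° y ->
  exists a b : R, [/\ expansion (conjugate f) y (grad (conjugate f) y),
    f (grad (conjugate f) y) = a%:E, conjugate f y = b%:E &
    a + b = dot (grad (conjugate f) y) y].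
Proof.
move=> [pf lf cf _ sc] iy; have [fN _] := pf.
have [x0 [a [b [fx fy ab]]]] := conj_maximizer pf lf iy.
have ex := attained_expansion fN lf cf sc fy fx ab.
have [_ gx] := iffLR (expansionP _ _ _) ex.
by exists a, b; rewrite gx.
Qed.

(** No [x] attains the supremum at the boundary point [y]. This failure persists near [x] and [y],
    and by compactness holds on the ball of radius [A] for all late [u n]; the gradient at [u n],
    being a maximiser, lies outside. *)
Lemma conj_blowup f (u : nat -> V) y : energy f ->
  (forall n, (dom (conjugate f))° (u n)) -> u @ \oo --> y ->
  ~ (dom (conjugate f))° y ->
  (fun n => `|grad (conjugate f) (u n)|) @ \oo --> +oo.
Proof.
move=> ef iu cu niy; have [lf _ _] := ef; have [pf lscf _ _ _] := lf.
have [fN [z0 /(fin_dom (fN _))[c0 fz0]]] := pf.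
apply/cvgryPgt => A.
(* [P n x] says that [u n] is not a subgradient of [f] at [x]. *)
pose P n x := exists z c, f z = c%:E /\ ((c + dot (x - z) (u n))%:E < f x)%E.
have : \forall n \near \oo, [set x | 0 <= `|x - 0| /\ `|x - 0| <= A] `<=` P n.
  have /compact_near_coveringP cK := @compact_annulus R m 0 0 A.
  apply: cK => x _.
  have [z [c [fz ltx]]] : exists z c, f z = c%:E /\ ((c + dot (x - z) y)%:E < f x)%E.
    apply: contrapT => nz.
    have sub z c : f z = c%:E -> (f x <= (c + dot (x - z) y)%:E)%E.
      by move=> fz; rewrite leNgt; apply/negP => ?; apply: nz; exists z, c.
    case fx : (f x) (fN x) (sub _ _ fz0) => [a| |]// _ _.
    apply: niy.
    have fy : conjugate f y = (dot x y - a)%:E.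
      apply/eqP; rewrite eq_le (conj_ge y fx) andbT.
      by apply: conj_le => // z c fz; have := sub _ _ fz; rewrite fx lee_fin !dotE; lra.
    by apply: (maximizer_interior lf fy fx); lra.
  have [b cb bf] := ereal_between ltx.
  have [U xU Uf] := lscf x b bf.
  (* Half of the slack pays for replacing [x] by [x'], half for replacing [y] by [u n]. *)
  pose e := (b - (c + dot (x - z) y)) / 2; have e0 : 0 < e by rewrite /e; lra.
  pose M : R := m.+1%:R * (`|x - z| + 1).
  have M0 : 0 < M by rewrite mulr_gt0// ltr_pwDr.
  have eM0 : 0 < e / M by rewrite divr_gt0.
  exists (U `&` [set x' | `|dot y x - dot y x'| < e] `&` [set x' | `|x - x'| < 1],
          [set n | `|y - u n| < e / M]).
    split => /=.
      apply: filterI; first apply: filterI => //.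
        have := @dot_continuous R m y x.
        by move=> /(@cvgrPdist_lt R R^o V (nbhs x))/(_ _ e0).
      apply/nearvP; exists 1 => // w w1 /=.
      by rewrite opprD addrA subrr add0r normrN.
    by move/cvgrPdist_lt : cu => /(_ _ eM0).
  move=> [x' n] /= [[[Ux' yx'] xx'] un]; exists z, c; split => //.
  apply: lt_trans (Uf _ Ux'); rewrite lte_fin.
  have h1 : dot (x' - z) (u n - y) <= e.
    rewrite (le_trans (dot_le _ _))// [`|u n - y|]distrC.
    have h : `|x' - z| <= `|x - z| + 1.
      rewrite (_ : x' - z = x' - x + (x - z)); last by rewrite addrA subrK.
      by rewrite (le_trans (ler_normD _ _))// addrC lerD2l distrC ltW.
    rewrite (@le_trans _ _ (M * (e / M)))//.
      by apply: ler_pM; rewrite ?mulr_ge0 ?ler_wpM2l// ltW.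
    by rewrite mulrCA divff ?mulr1 ?gt_eqF.
  move: yx'; rewrite ltr_norml !(dotC y) => /andP[h2 h3].
  have eE : e = (b - (c + dot x y - dot z y)) / 2 by rewrite /e !dotE; lra.
  by clearbody e; move: h1; rewrite !dotE => h1; lra.
apply: filterS => n KP; rewrite ltNge; apply/negP => gA.
have [a [b [_ fg fu ab]]] := conj_interior_attained lf (iu n).
have [|z [c [fz]]] := KP (grad (conjugate f) (u n)); first by rewrite /= subr0.
by rewrite fg lte_fin dotBl; have := young fz fu; lra.
Qed.

Lemma conj_essentially_smooth f : energy f -> essentially_smooth (conjugate f).
Proof.
move=> ef; have [lf _ _] := ef; split.
- by exists 0; exact: conj_interior0.
- move=> y /(conj_interior_attained lf)[a [b [ex _ _ _]]].
  exact: expansion_differentiable ex.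
- by move=> u y; exact: conj_blowup.
Qed.

(** Without strictness the maximiser [g] at the intermediate point is also one at [x] and at [y].
    Both are then subgradients of [f] at [g], where [f] is differentiable. *)
Lemma conj_essentially_strictly_convex f : energy f ->
  essentially_strictly_convex (conjugate f).
Proof.
move=> ef C subC /convex_setP cC x y t Cx Cy xy t0 t1.
have [lf _ _] := ef; have [pf lscf cf sm _] := lf; have [fN _] := pf.
have cN z := conj_gtNy z pf.
have int z : C z -> (dom (conjugate f))° z.
  move=> /subC[g]; apply: essentially_smooth_subdiff => //.
  - exact: conj_convex.
  - exact: conj_essentially_smooth.
  - exact: conj_interior0.
pose z := t *: x + (1 - t) *: y.
have [a [s [ex fg fz ags]]] := conj_interior_attained lf (int _ (cC _ _ _ Cx Cy t0 t1)).
have [_ [p [_ _ fx _]]] := conj_interior_attained lf (int _ Cx).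
have [_ [q [_ _ fy _]]] := conj_interior_attained lf (int _ Cy).
rewrite fx fy fz -!EFinM -EFinD lte_fin ltNge; apply/negP => le.
set g := grad _ _ in ex fg ags.
have yx := young fg fx; have yy := young fg fy.
move: ags; rewrite !dotE => ags.
(* The two weighted Young gaps are nonnegative with nonpositive sum, so both vanish. *)
have h1 : 0 <= t * (a + p - dot g x) by rewrite mulr_ge0 ?(ltW t0)// subr_ge0.
have t1' : 0 < 1 - t by lra.
have h2 : 0 <= (1 - t) * (a + q - dot g y) by rewrite mulr_ge0 ?(ltW t1')// subr_ge0.
have e1 : t * (a + p - dot g x) = 0 by lra.
have e2 : (1 - t) * (a + q - dot g y) = 0 by lra.
have {}e1 : a + p = dot g x.
  by move/eqP: e1; rewrite mulf_eq0 gt_eqF//= => /eqP; lra.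
have {}e2 : a + q = dot g y.
  by move/eqP: e2; rewrite mulf_eq0 gt_eqF//= => /eqP; lra.
have [_ sx] := attained_subdifferential fN fx fg e1.
have [_ sy] := attained_subdifferential fN fy fg e2.
have ig : (dom f)° g.
  apply: (essentially_smooth_subdiff fN cf sm (energy_interior0 ef)).
  exact: attained_subdifferential fx fg e1.
have [_ df _] := sm; have eg := differentiable_expansion (df _ ig).
rewrite fg in sx sy.
by move/eqP: xy; apply; rewrite (expansion_subgrad eg fg sx) (expansion_subgrad eg fg sy).
Qed.

End Energy.

(** * The dual of an arbitrary norm *)

Section DualNorm.
Context {R : realType} {m : nat}.
Local Notation V := ('rV[R]_m).
Implicit Types (f : V -> \bar R) (x y z : V).
Variable N : V -> R.
Hypothesis normN : is_norm N.

Let ND x y : N (x + y) <= N x + N y. Proof. by case: normN. Qed.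
Let NZ a x : N (a *: x) = `|a| * N x. Proof. by case: normN. Qed.
Let Neq0 x : N x = 0 -> x = 0. Proof. by case: normN => _ _; exact. Qed.
Let N0 : N 0 = 0. Proof. by rewrite -(scale0r 0) NZ normr0 mul0r. Qed.
Let Nopp x : N (- x) = N x.
Proof. by rewrite -scaleN1r NZ normrN1 mul1r. Qed.

Lemma is_norm_ge0 x : 0 <= N x.
Proof. by have := ND x (- x); rewrite subrr N0 Nopp; lra. Qed.

Lemma is_norm_ub : exists2 K : R, 0 < K & forall x, N x <= K * `|x|.
Proof.
pose S := \sum_(i < m) N (delta_mx 0 i).
have S0 : 0 <= S by apply: sumr_ge0 => i _; exact: is_norm_ge0.
exists (S + 1) => [|x]; first by rewrite ltr_pwDr.
have h : N x <= \sum_(i < m) `|x 0 i| * N (delta_mx 0 i).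
  rewrite {1}(row_sum_delta x).
  elim/big_ind2 : _ => [|u v u' v' h1 h2|i _]; first by rewrite N0.
    by apply: le_trans (ND _ _) _; exact: lerD.
  by rewrite NZ.
apply: (le_trans h); rewrite mulrDl mul1r (@le_trans _ _ (S * `|x|)) ?lerDl//.
rewrite mulr_suml; apply: ler_sum => i _.
by rewrite mulrC ler_wpM2l ?is_norm_ge0// normv_coord.
Qed.

(** [N] is continuous and positive on the compact unit sphere of the sup norm. *)
Lemma is_norm_lb : exists2 c : R, 0 < c & forall x, c * `|x| <= N x.
Proof.
have [K K0 NK] := is_norm_ub.
have lN : lower_semicontinuous (fun x => (N x)%:E).
  move=> x a; rewrite lte_fin => ax.
  exists [set x' | a < N x'] => //; apply/nearvP.
  exists ((N x - a) / K) => [|z]; first by rewrite divr_gt0// subr_gt0.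
  rewrite ltr_pdivlMr// => zK.
  have := ND (x + z) (- z); rewrite addrK Nopp; have := NK z; rewrite /=; lra.
have [|c c0 hc] := lsc_compact_gap (c := 0) lN (@compact_annulus R m 0 1 1).
  move=> x [x1 _]; rewrite lte_fin lt_neqAle is_norm_ge0 andbT eq_sym.
  apply/eqP => /Neq0 x0; move: x1; rewrite x0 subr0 normr0; lra.
exists c => // x; have [->|x0] := eqVneq x 0; first by rewrite normr0 mulr0 N0.
have nx : 0 < `|x| by rewrite normr_gt0.
have := hc (`|x|^-1 *: x); rewrite /= subr0 normrZ normfV normr_id mulVf ?gt_eqF//.
move=> /(_ (conj (lexx _) (lexx _))); rewrite add0r lee_fin NZ normfV normr_id.
by rewrite mulrC ler_pdivlMr.
Qed.

Definition dual_norm y := sup [set dot x y | x in [set x | N x <= 1]].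

Let dual_has_sup y : has_sup [set dot x y | x in [set x | N x <= 1]].
Proof.
split; first by exists (dot 0 y); exists 0; rewrite //= N0.
have [c c0 hc] := is_norm_lb.
exists (m.+1%:R * c^-1 * `|y|) => _ [x /= x1 <-].
rewrite (le_trans (dot_le _ _))// ler_wpM2r// ler_wpM2l//.
by rewrite -[c^-1]mul1r ler_pdivlMr// mulrC (le_trans (hc x)).
Qed.

Lemma dual_norm_ub x y : N x <= 1 -> dot x y <= dual_norm y.
Proof. by move=> x1; apply: sup_upper_bound => //; exists x. Qed.

Lemma dual_norm_le y (B : R) : (forall x, N x <= 1 -> dot x y <= B) ->
  dual_norm y <= B.
Proof.
move=> h; apply: ge_sup; first by have [] := dual_has_sup y.
by move=> _ [x /= x1 <-]; exact: h.
Qed.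

Lemma dual_norm_gt y (B : R) : B < dual_norm y ->
  exists2 x, N x <= 1 & B < dot x y.
Proof.
move=> h; apply: contrapT => nx; move: h; apply/negP; rewrite -leNgt.
apply: dual_norm_le => x x1; rewrite leNgt; apply/negP => hx.
by apply: nx; exists x.
Qed.

Lemma dot_dual_norm x y : dot x y <= N x * dual_norm y.
Proof.
have [x0|x0] := eqVneq (N x) 0; first by rewrite x0 (Neq0 x0) mul0r dot0l.
have Nx : 0 < N x by rewrite lt_neqAle eq_sym x0 is_norm_ge0.
have := @dual_norm_ub ((N x)^-1 *: x) y; rewrite NZ normfV gtr0_norm//.
by rewrite mulVf// => /(_ (lexx _)); rewrite dotZl mulrC ler_pdivrMr// mulrC.
Qed.

Lemma dual_norm_is_norm : is_norm dual_norm.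
Proof.
split=> [x y|a x|y y0].
- apply: dual_norm_le => z z1; rewrite dotDr.
  by apply: lerD; exact: dual_norm_ub.
- have le (b : R) u : dual_norm (b *: u) <= `|b| * dual_norm u.
    apply: dual_norm_le => z z1; rewrite dotZr.
    (* The sign of [b] moves to [z], which stays in the unit ball. *)
    have -> : b * dot z u = `|b| * dot (Num.sg b *: z) u.
      by rewrite dotZl mulrA [`|b| * _]mulrC -numEsg.
    rewrite ler_wpM2l// dual_norm_ub// NZ normr_sg.
    by case: (_ != _); rewrite ?mul1r ?mul0r.
  apply/eqP; rewrite eq_le le/=.
  have [->|a0] := eqVneq a 0.
    rewrite normr0 mul0r; have := @dual_norm_ub 0 (0 *: x).
    by rewrite N0 dot0l; apply; exact: ler01.
  have := le a^-1 (a *: x); rewrite scalerA mulVf// scale1r normfV.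
  by rewrite ler_pdivlMl ?normr_gt0.
- apply: dotxx_le0; have := dot_dual_norm y y.
  by rewrite y0 mulr0.
Qed.

End DualNorm.

(** * Conjugates of energy functions *)

Section EnergyConjugate.
Context {R : realType} {m : nat}.
Local Notation V := ('rV[R]_m).
Implicit Types (f : V -> \bar R) (x y z : V).

(** [x'] has the same [N] as a point between 0 and [x], where convexity and minimality at 0
    apply. *)
Lemma radial_mono f N fo x x' : energy f -> is_norm N ->
  (forall x, f x = fo (N x)) -> N x' <= N x -> (f x' <= f x)%E.
Proof.
move=> ef nN fE; have [_ NZ N0] := nN.
have [[[fN _] _ cf _ _] minf _] := ef.
have f0 z : (f 0%R <= f z)%E by have [->//|/minf/ltW] := eqVneq z 0.
rewrite le_eqVlt => /predU1P[xx'|lt]; first by rewrite !fE xx'.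
have [/N0 ->//|x'0] := eqVneq (N x') 0.
have Nx' : 0 < N x' by rewrite lt_neqAle eq_sym x'0 is_norm_ge0.
have Nx : 0 < N x by lra.
pose t := N x' / N x.
have t0 : 0 < t by rewrite divr_gt0.
have t1 : t < 1 by rewrite ltr_pdivrMr// mul1r.
have -> : f x' = f (t *: x + (1 - t) *: 0).
  by rewrite scaler0 addr0 !fE NZ gtr0_norm// divfK ?gt_eqF.
apply: (le_trans (cf _ _ _ t0 t1)).
case fx : (f x) (fN x) => [a| |]// _; last by rewrite leey.
have := f0 x; rewrite fx; case: (f 0) (fN 0) => [b| |]// _.
rewrite -!EFinM -EFinD !lee_fin => ba.
have : (1 - t) * b <= (1 - t) * a by rewrite ler_pM2l//; lra.
lra.
Qed.

Lemma conj_radial f : energy f -> radial (conjugate f).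
Proof.
move=> ef; have [[[fN _] _ _ _ _] _ [N [fo [nN fE]]]] := ef.
have [_ NZ Neq0] := nN.
have mono y y' : dual_norm N y <= dual_norm N y' ->
    (conjugate f y <= conjugate f y')%E.
  move=> yy'; apply: ge_ereal_sup => _ [x dx <-].
  have [a fx] := fin_dom (fN _) dx; rewrite fx -EFinB.
  rewrite leNgt; apply/negP => lt.
  have := conj_ge y' fx; move: lt.
  case E : (conjugate f y') => [c| |]//; rewrite lte_fin lee_fin => lt le.
  have [x0|x0] := eqVneq (N x) 0.
    by move: lt le; rewrite (Neq0 _ x0) !dot0l; lra.
  have Nx : 0 < N x by rewrite lt_neqAle eq_sym x0 is_norm_ge0.
  (* A vector of the unit ball that nearly norms [y'], scaled by [N x], has [f] at most [a] but
     pairs with [y'] to more than [c + a], against Young. *)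
  have [|x1 x11 hx1] := @dual_norm_gt _ _ N nN y' ((c + a) / N x).
    rewrite ltr_pdivrMr//.
    have := dot_dual_norm nN x y.
    have : N x * dual_norm N y <= N x * dual_norm N y' by rewrite ler_pM2l.
    by rewrite (mulrC (dual_norm _ _)); lra.
  have := @radial_mono f N fo x (N x *: x1) ef nN fE.
  rewrite NZ gtr0_norm// ler_piMr ?(ltW Nx)// => /(_ isT).
  case fx1 : (f (N x *: x1)) (fN (N x *: x1)) => [a'| |]// _; rewrite fx// lee_fin => aa.
  have := young fx1 E; rewrite dotZl.
  by move: hx1; rewrite ltr_pdivrMr// mulrC; lra.
(* The profile evaluates the conjugate at any vector of dual norm [s]; the default 0 occurs only for
   [s] that no vector has. *)
exists (dual_norm N), (fun s => conjugate f (xget 0 [set y | dual_norm N y = s])).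
split; first exact: dual_norm_is_norm.
move=> y; set y' := xget _ _.
have E : dual_norm N y' = dual_norm N y.
  by apply: (@xgetPex _ 0 [set z | dual_norm N z = dual_norm N y]); exists y.
by apply/eqP; rewrite eq_le; apply/andP; split; apply: mono; rewrite E.
Qed.

Lemma energy_conjugate f : energy f -> energy (conjugate f).
Proof.
move=> ef; have [a [f0 _]] := energy_expansion0 ef.
have [[pf _ _ _ _] _ _] := ef; split; last exact: conj_radial.
  split.
  - split; first by move=> y; exact: conj_gtNy.
    exact: ex_intro (dom_fin (conj0 ef f0)).
  - exact: conj_lsc.
  - exact: conj_convex.
  - exact: conj_essentially_smooth.
  - exact: conj_essentially_strictly_convex.
by move=> y; exact: conj_min.
Qed.

End EnergyConjugate.

(** * Smoothness and convexity under conjugation *)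

Section Duality.
Context {R : realType} {m : nat}.
Local Notation V := ('rV[R]_m).
Implicit Types (f G Psi : V -> \bar R) (x y z mu nu : V).

Lemma taylor_remE G mu nu (a b : R) : G mu = a%:E -> G nu = b%:E ->
  taylor_rem G mu nu = (a - b - dot (grad G nu) (mu - nu))%:E.
Proof. by rewrite /taylor_rem => -> ->. Qed.

Lemma energy_local_ub Psi : energy Psi ->
  exists2 r : R, 0 < r & exists C : R, forall z, `|z| < r -> (Psi z <= C%:E)%E.
Proof.
move=> eP; have [a [P0 ex]] := energy_expansion0 eP.
have [r r0 hr] := expansion_ub ex P0 ltr01.
exists r => //; exists (a + r) => z zr.
have := hr _ zr; rewrite add0r dot0l => /le_trans; apply.
by rewrite lee_fin; lra.
Qed.

Lemma attained_grad G x y (a b : R) : (forall x, (-oo < G x)%E) ->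
  differentiable_at G x -> G x = a%:E -> conjugate G y = b%:E ->
  a + b = dot x y -> grad G x = y.
Proof.
move=> GN dG Gx Gy ab; have [_ sub] := attained_subdifferential GN Gy Gx ab.
apply/esym/(expansion_subgrad (differentiable_expansion dG) Gx) => z.
by have := sub z; rewrite Gx.
Qed.

(* Near a boundary point of the domain, smoothness bounds G above, whereas
   lower semicontinuity forces G to tend to +oo. *)
Lemma H_smooth_dom G Psi : proper_fun G -> lower_semicontinuous G ->
  differentiable_on_dom G -> H_smooth Psi G -> forall x, dom G x.
Proof.
move=> [GN [x0 dx0]] lG dG [eP sm] p.
have oG : open (dom G).
  rewrite openE => x /dG[+ _]; apply: filterS => z.
  by rewrite fin_numElt => /andP[].
have cG : closed (dom G).
  move=> q cq; apply: contrapT => ndq.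
  have [r r0 [C hC]] := energy_local_ub eP.
  have r20 : 0 < r / 2 by lra.
  have bq : nbhs q [set x | `|x - q| < r / 2].
    by apply/nearvP; exists (r / 2) => // z; rewrite /= addrAC subrr add0r.
  have [nu [dnu qnu]] := cq _ bq.
  have [b Gnu] := fin_dom (GN _) dnu.
  (* Near [q], where [G] is [+oo], values exceed what smoothness based at [nu] allows. *)
  have [U qU UG] : exists2 U, nbhs q U & forall z, U z ->
      ((b + m.+1%:R * `|grad G nu| * r + C)%:E < G z)%E.
    apply: lG; rewrite /dom /= in ndq; move/negP: ndq; rewrite -leNgt leye_eq => /eqP ->.
    exact: ltry.
  have [mu [dmu [Umu qmu]]] := cq _ (filterI qU bq).
  have [a Gmu] := fin_dom (GN _) dmu.
  have mn : `|mu - nu| < r.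
    have -> : mu - nu = (mu - q) - (nu - q) by rewrite opprB addrA subrK.
    rewrite (le_lt_trans (ler_normB _ _))//; move: qnu qmu => /=; lra.
  have := UG _ Umu; rewrite Gmu lte_fin; apply/negP; rewrite -leNgt.
  have := le_trans (sm mu nu dmu dnu) (hC _ mn).
  rewrite (taylor_remE Gmu Gnu) lee_fin.
  have : dot (grad G nu) (mu - nu) <= m.+1%:R * `|grad G nu| * r.
    by rewrite (le_trans (dot_le _ _))// ler_wpM2l ?mulr_ge0// ltW.
  lra.
(* The domain is open and closed, so its preimage under the line through [x0] and [p] is the whole
   connected real line. *)
pose l (t : R^o) : V := x0 + t *: (p - x0).
have cl : continuous l.
  by move=> t; apply: cvgD; [exact: cvg_cst|apply: cvgZr_tmp; exact: cvg_id].
have /connected_intervalP cR : is_interval [set: R] by [].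
have lE : l @^-1` dom G = [set: R].
  apply: cR.
  - by exists 0; rewrite /= /l scale0r addr0.
  - exists (l @^-1` dom G); last by rewrite setTI.
    by apply: open_comp => // t _; exact: cl.
  - exists (l @^-1` dom G); last by rewrite setTI.
    by apply: closed_comp => // t _; exact: cl.
have : (l @^-1` dom G) 1 by rewrite lE.
by rewrite /= /l scale1r addrC subrK.
Qed.

Lemma H_smooth_conjugate G Psi : proper_fun G -> lower_semicontinuous G ->
  differentiable_on_dom G -> differentiable_on_dom (conjugate G) ->
  H_smooth Psi G -> H_convex (conjugate Psi) (conjugate G).
Proof.
move=> pG lG dG dGs smG; have Gdom := H_smooth_dom pG lG dG smG.
have [eP sm] := smG; have [GN _] := pG.
split; first exact: energy_conjugate.
move=> y y0 dy dy0; have [c Gy] := fin_dom (conj_gtNy _ pG) dy.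
have [b Gy0] := fin_dom (conj_gtNy _ pG) dy0.
rewrite (taylor_remE Gy Gy0); set nu := grad (conjugate G) y0.
have Gnu := conj_attained GN lG (differentiable_expansion (dGs _ dy0)) Gy0.
rewrite -/nu in Gnu.
have gnu : grad G nu = y0.
  by apply: (attained_grad GN (dG _ (Gdom _)) Gnu Gy0); lra.
have [[[PN _] _ _ _ _] _ _] := eP.
apply: conj_le => // x p Px.
(* [nu + x] competes in [conjugate G y], and smoothness at [nu] bounds [G] there. *)
have [q Gq] := fin_dom (GN _) (Gdom (nu + x)).
have := sm _ _ (Gdom (nu + x)) (Gdom nu).
rewrite (taylor_remE Gq Gnu) gnu [nu + x]addrC addrK Px lee_fin => h.
have := young Gq Gy; rewrite !dotE (dotC y0) in h *; lra.
Qed.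

(* The range of the gradient of the conjugate contains a ball of fixed radius
   around each of its points: the tilted conjugate is coercive there. *)
Lemma H_convex_grad_onto G Psi : proper_fun G -> energy Psi ->
  dom (conjugate G) !=set0 ->
  differentiable_on_dom (conjugate G) ->
  H_convex (conjugate Psi) (conjugate G) ->
  forall nu, exists y, dom (conjugate G) y /\ grad (conjugate G) y = nu.
Proof.
move=> pG eP [y00 dy00] dGs [_ cv] nu.
have [[[PN _] _ _ _ _] _ _] := eP.
have GsN y := conj_gtNy y pG.
have [r r0 [C hC]] := energy_local_ub eP.
(* A bound for [Psi] on a ball of radius [r] gives its conjugate growth of slope [r / 2]. *)
have low z : ((r / 2 * `|z| - C)%:E <= conjugate Psi z)%E.
  have [w w1 zw] := dot_normer z.
  have wr : `|(r / 2) *: w| < r.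
    rewrite normrZ gtr0_norm; last lra.
    by rewrite (@le_lt_trans _ _ (r / 2))//; [rewrite ler_piMr//; lra|lra].
  have := hC _ wr; case Pw : (Psi _) (PN ((r / 2) *: w)) => [p| |]// _.
  rewrite lee_fin => pC; apply: le_trans (conj_ge z Pw).
  by rewrite lee_fin dotZl (dotC w) zw; lra.
(* Tilting by a vector of norm at most [rho] uses up at most half of that slope. *)
pose rho : R := r / (4 * m.+1%:R).
have rho0 : 0 < rho by rewrite divr_gt0// mulr_gt0.
have rhoE : r / 4 = m.+1%:R * rho.
  have : m.+1%:R != 0 :> R by rewrite pnatr_eq0.
  by rewrite /rho; move: (m.+1%:R) => M M0; field.
pose S := [set nu | exists y, dom (conjugate G) y /\ grad (conjugate G) y = nu].
have step nu0 mu : S nu0 -> `|mu - nu0| <= rho -> S mu.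
  move=> [y0 [dy0 <-]]; set g := grad _ _ => near_mu.
  have [b Gy0] := fin_dom (GsN _) dy0.
  have [y|y yM|y1 y1min] := @lsc_coercive_min R m (tilt (conjugate G) mu 0) y0
    (4 * `|C| / r) (tilt_lsc (y:=mu) (c:=0) (@conj_lsc R m G)).
  - by rewrite /tilt; case: (conjugate G y) (GsN y) => [c| |]//; rewrite ?ltNyr.
  - rewrite /tilt; case Gy : (conjugate G y) (GsN y) => [c| |]// _; last first.
      by rewrite addye// leey.
    rewrite Gy0 -!EFinD lee_fin.
    have := le_trans (low _) (cv _ _ (dom_fin Gy) dy0).
    rewrite (taylor_remE Gy Gy0) -/g lee_fin => h1.
    have h2 : dot (mu - g) (y - y0) <= r / 4 * `|y - y0|.
      rewrite (le_trans (dot_le _ _))// ler_wpM2r//.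
      by rewrite rhoE ler_wpM2l.
    have h3 : `|C| <= r / 4 * `|y - y0|.
      by move: yM; rewrite ltr_pdivrMr// => yM; lra.
    have h4 := ler_norm C.
    move: h1 h2; rewrite !dotE !(dotC mu) => h1 h2; lra.
  have := y1min y0; rewrite /tilt Gy0.
  case Gy1 : (conjugate G y1) (GsN y1) => [b1| |]// _ _.
  have dy1 := dom_fin Gy1.
  exists y1; split => //; apply/esym.
  apply: (expansion_subgrad (differentiable_expansion (dGs _ dy1)) Gy1) => y.
  case Gy : (conjugate G y) (GsN y) => [c| |]// _; last by rewrite leey.
  have := y1min y; rewrite /tilt Gy1 Gy -!EFinD !lee_fin dotBr !(dotC mu); lra.
pose g0 := grad (conjugate G) y00.
(* Enough steps of length at most [rho] to lead from [g0] to [nu]. *)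
pose n := Num.bound (`|nu - g0| / rho).
have n0 : `|nu - g0| / rho < n%:R by apply: archi_boundP; rewrite divr_ge0// ltW.
have np : (0 : R) < n%:R by apply: le_lt_trans n0; rewrite divr_ge0// ltW.
pose d : V := n%:R^-1 *: (nu - g0).
have dr : `|d| <= rho.
  rewrite normrZ normfV gtr0_norm// mulrC ler_pdivrMr// mulrC -ler_pdivrMr//.
  exact: ltW.
have walk k : S (g0 + k%:R *: d).
  elim: k => [|k ih]; first by exists y00; rewrite scale0r addr0.
  apply: (step _ _ ih).
  by rewrite -natr1 scalerDl scale1r addrA [_ + d]addrC addrK.
have := walk n; rewrite /d scalerA divff ?gt_eqF// scale1r.
by rewrite addrC subrK.
Qed.

(** Every [x] is a gradient of the conjugate at some [y], which yields [G x] from the conjugate.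
    Testing [conjugate Psi] at [y1 - y0] with the single point [mu - nu] gives the bound. *)
Lemma H_convex_conjugate G Psi : proper_fun G -> lower_semicontinuous G ->
  energy Psi -> dom (conjugate G) !=set0 ->
  differentiable_on_dom G -> differentiable_on_dom (conjugate G) ->
  H_convex (conjugate Psi) (conjugate G) -> H_smooth Psi G.
Proof.
move=> pG lG eP d0 dG dGs cvG; have onto := H_convex_grad_onto pG eP d0 dGs cvG.
have [_ cv] := cvG; have [GN _] := pG.
have [[[PN _] _ _ _ _] _ _] := eP.
split=> // mu nu dmu dnu.
have att x : exists y b, [/\ dom (conjugate G) y, conjugate G y = b%:E,
    grad (conjugate G) y = x & G x = (dot x y - b)%:E].
  have [y [dy gy]] := onto x; have [b Gy] := fin_dom (conj_gtNy _ pG) dy.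
  exists y, b; split => //; apply: conj_attained => //.
  by rewrite -gy; apply: differentiable_expansion; exact: dGs.
have [y0 [b0 [dy0 Gy0 gy0 Gnu]]] := att nu.
have [y1 [b1 [dy1 Gy1 gy1 Gmu]]] := att mu.
have gnu : grad G nu = y0 by apply: (attained_grad GN (dG _ dnu) Gnu Gy0); lra.
rewrite (taylor_remE Gmu Gnu) gnu.
case P : (Psi (mu - nu)) (PN (mu - nu)) => [p| |]// _; last by rewrite leey.
have := le_trans (conj_ge (y1 - y0) P) (cv _ _ dy1 dy0).
rewrite (taylor_remE Gy1 Gy0) gy0 !lee_fin !dotE !(dotC y0); lra.
Qed.

End Duality.

(** * Affine shifts, rescaling and averages *)

Section Shift.
Context {R : realType} {m : nat}.
Local Notation V := ('rV[R]_m).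
Implicit Types (f G Psi : V -> \bar R) (x y z mu nu g : V).

Lemma tilt_dom f y c x : dom (tilt f y c) x <-> dom f x.
Proof.
rewrite /dom /tilt /=; case: (f x) => [a| |]//=.
by split=> _; [exact: ltry|rewrite -EFinD ltry].
Qed.

Lemma tilt_expansion f y c x g :
  expansion f x g -> expansion (tilt f y c) x (g - y).
Proof.
move=> ex e e0; have [d d0 hd] := ex e e0; have [b fx] := expansion_fin ex.
exists d => // z /hd[fz]; rewrite /tilt fx -(fineK fz) -!EFinD /= => h.
split => //; move: h; congr (`|_| <= _).
by rewrite !dotE (dotC z) (dotC x); lra.
Qed.

Lemma tilt_taylor_rem f y c mu nu : (forall x, (-oo < f x)%E) ->
  differentiable_on_dom f -> dom f mu -> dom f nu ->
  taylor_rem (tilt f y c) mu nu = taylor_rem f mu nu.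
Proof.
move=> fN df dmu dnu; have [a fmu] := fin_dom (fN _) dmu.
have [b fnu] := fin_dom (fN _) dnu.
have [_ g] := iffLR (expansionP _ _ _)
  (tilt_expansion y c (differentiable_expansion (df _ dnu))).
rewrite (@taylor_remE _ _ _ _ _ (a + (c - dot mu y)) (b + (c - dot nu y)));
  rewrite ?/tilt ?fmu ?fnu//.
rewrite (taylor_remE fmu fnu) g; congr (_%:E).
by rewrite !dotE !(dotC y); lra.
Qed.

Lemma H_smooth_tilt f Psi y c : (forall x, (-oo < f x)%E) ->
  differentiable_on_dom f -> H_smooth Psi (tilt f y c) <-> H_smooth Psi f.
Proof.
move=> fN df; split=> -[eP sm]; split => // mu nu dmu dnu.
  by rewrite -(tilt_taylor_rem y c)//; apply: sm; exact/tilt_dom.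
by move/tilt_dom: dmu => dmu; move/tilt_dom: dnu => dnu; rewrite tilt_taylor_rem//; exact: sm.
Qed.

Lemma H_convex_tilt f psi y c : (forall x, (-oo < f x)%E) ->
  differentiable_on_dom f -> H_convex psi (tilt f y c) <-> H_convex psi f.
Proof.
move=> fN df; split=> -[eP sm]; split => // mu nu dmu dnu.
  by rewrite -(tilt_taylor_rem y c)//; apply: sm; exact/tilt_dom.
by move/tilt_dom: dmu => dmu; move/tilt_dom: dnu => dnu; rewrite tilt_taylor_rem//; exact: sm.
Qed.

Lemma fenchel_youngl G s (c : R) : conjugate G s = c%:E ->
  (fun mu => fenchel_young G mu s) = tilt G s c.
Proof.
by move=> Gs; apply/funext => mu; rewrite /fenchel_young /tilt Gs -addeA.
Qed.

Lemma fenchel_youngr G s (c : R) : G s = c%:E ->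
  (fun nu => fenchel_young G s nu) = tilt (conjugate G) s c.
Proof.
move=> Gs; apply/funext => nu.
by rewrite /fenchel_young /tilt Gs [(c%:E + _)%E]addeC -addeA dotC.
Qed.

(** In the sum of the two inequalities based at the midpoint the gradient terms cancel, and [psi] is
    even. *)
Lemma H_convex_midpoint G psi x x' (a a' b : R) : standing G -> H_convex psi G ->
  G x = a%:E -> G x' = a'%:E -> G (2^-1 *: (x + x')) = b%:E ->
  (psi (2^-1 *: (x - x'))%R <= ((a + a') / 2 - b)%:E)%E.
Proof.
move=> [[GN _] cG _] [eP cv] Gx Gx' Gz.
set z := 2^-1 *: (x + x') in Gz.
have [[[PN _] _ _ _ _] _ rP] := eP.
have half (u : V) : u = 2^-1 *: (u + u).
  by rewrite -mulr2n -[u *+ 2]scaler_nat scalerA mulVf ?scale1r.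
have E1 : x - z = 2^-1 *: (x - x').
  by rewrite {1}(half x) -scalerBr addrC opprD addrACA addNr add0r addrC.
have E2 : x' - z = - (2^-1 *: (x - x')).
  by rewrite {1}(half x') -scalerBr -scalerN opprB opprD addrACA subrr addr0.
have := cv _ _ (dom_fin Gx) (dom_fin Gz); have := cv _ _ (dom_fin Gx') (dom_fin Gz).
rewrite (taylor_remE Gx Gz) (taylor_remE Gx' Gz) E1 E2 radial_opp//.
case: (psi _) (PN (2^-1 *: (x - x'))) => [p| |]// _.
by rewrite !lee_fin !dotNr; lra.
Qed.

(* An almost minimizing sequence of G - <., y> is Cauchy by the midpoint
   inequality; its limit is the gradient of the conjugate at y. *)
Lemma H_convex_conj_differentiable G psi : standing G -> H_convex psi G ->
  (0 <= psi 0%R)%E -> differentiable_on_dom (conjugate G).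
Proof.
move=> stG cvG p0 y dy.
have [pG cG _] := stG; have [GN _] := pG; have [eP _] := cvG.
have [[[PN _] lP cP _ _] minP _] := eP.
have [b Gy] := fin_dom (conj_gtNy _ pG) dy.
(* Young's inequality at the midpoint bounds [psi] by the average of the two gaps. *)
have mid x x' a a' : G x = a%:E -> G x' = a'%:E ->
    (psi (2^-1 *: (x - x'))%R <= ((a - dot x y + b + (a' - dot x' y + b)) / 2)%:E)%E.
  move=> Gx Gx'.
  have dz : dom G (2^-1 *: (x + x')).
    have h0 : (0 : R) < 2^-1 by lra.
    have h1 : (2^-1 : R) < 1 by lra.
    have := iffLR (convex_setP _) cG x x' _ (dom_fin Gx) (dom_fin Gx') h0 h1.
    by have -> : 1 - 2^-1 = 2^-1 :> R by [lra]; rewrite -scalerDr.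
  have [c Gz] := fin_dom (GN _) dz.
  apply: (le_trans (H_convex_midpoint stG cvG Gx Gx' Gz)).
  by have := young Gz Gy; rewrite lee_fin dotZl dotDl; lra.
have ppos x : x != 0 -> (0 < psi x)%E by move=> /minP; exact: le_lt_trans.
(* Convexity at [mu = nu] gives [psi 0 <= 0], as [convex_growth] requires. *)
have [[x1 dx1] p00] : dom G !=set0 /\ (psi 0%R <= 0)%E.
  have [_ [x dx]] := pG; split; first by exists x.
  have [a Gx] := fin_dom (GN _) dx.
  have := proj2 cvG _ _ dx dx; rewrite (taylor_remE Gx Gx) subrr dot0r.
  by rewrite subr0 subrr.
have grow := convex_growth cP lP p00 ppos.
have seq_ex (n : nat) : exists x, exists a, G x = a%:E /\ a - dot x y + b < n.+1%:R^-1.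
  have : (0 : R) < n.+1%:R^-1 by rewrite invr_gt0.
  move: (n.+1%:R^-1) => k k0; apply: contrapT => nx.
  suff : (conjugate G y <= (b - k)%:E)%E by rewrite Gy lee_fin; lra.
  apply: conj_le => // x a Gx; rewrite leNgt; apply/negP => h; apply: nx.
  by exists x, a; split => //; lra.
have [u hu] := choice seq_ex; have {hu}[h hu] := choice hu.
have close e : 0 < e -> exists2 k : R, 0 < k & forall x x' a a',
    G x = a%:E -> G x' = a'%:E -> a - dot x y + b < k -> a' - dot x' y + b < k ->
    `|x - x'| < e.
  move=> e0; have e20 : 0 < e / 2 by lra.
  have [d d0 hd] := grow _ e20; exists (d * (e / 2)); first by rewrite mulr_gt0.
  move=> x x' a a' Gx Gx' ax ax'; rewrite ltNge; apply/negP => far.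
  have := hd (2^-1 *: (x - x')); rewrite subr0 normrZ gtr0_norm ?invr_gt0//.
  have h1 : e / 2 <= 2^-1 * `|x - x'| by lra.
  move=> /(_ h1) /le_trans/(_ (mid _ _ _ _ Gx Gx')); rewrite lee_fin.
  have : d * (e / 2) <= d * (2^-1 * `|x - x'|) by rewrite ler_pM2l.
  lra.
have small k : 0 < k -> \forall n \near \oo, h n - dot (u n) y + b < k.
  move=> k0; have := @cvg_harmonic R => /cvgrPdist_lt/(_ _ k0).
  apply: filterS => n; rewrite sub0r normrN /= ger0_norm ?invr_ge0// => h1.
  by have [_ h2] := hu n; exact: lt_trans h2 h1.
have cvu : cvg (u @ \oo).
  apply/cauchy_cvgP/cauchy_ballP => e e0; have [k k0 hk] := close _ e0.
  exists ([set u n | n in [set n | h n - dot (u n) y + b < k]],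
          [set u n | n in [set n | h n - dot (u n) y + b < k]]).
    by split; apply: filterS (small _ k0) => n hn /=; exists n.
  move=> [x x'] /= [[n hn <-] [n' hn' <-]].
  rewrite -ball_normE /=; apply: hk hn hn'; by have [] := hu n; have [] := hu n'.
pose x0 := lim (u @ \oo).
have lim_dot y' : dot (u n) y' @[n --> \oo] --> dot x0 y'.
  under eq_fun do rewrite dotC.
  rewrite dotC; apply: continuous_cvg; last exact: cvu.
  exact: dot_continuous.
apply: (@expansion_differentiable R m _ _ x0); apply: (conj_expansion GN Gy).
  (* The subgradient inequality for [x0] is the limit of Young's inequality along [u]. *)
  move=> y'; case E : (conjugate G y') (conj_gtNy y' pG) => [c| |]// _; last by rewrite leey.
  rewrite lee_fin; apply/ler_addgt0Pr => e e0.
  have e20 : 0 < e / 2 by lra.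
  have : \forall n \near \oo, b + dot x0 (y' - y) <= c + e.
    have /cvgrPdist_lt/(_ _ e20) := lim_dot (y' - y).
    have := small _ e20; apply: filterS2 => n h1.
    rewrite ltr_norml => /andP[_ h2].
    have := young (proj1 (hu n)) E; move: h2; rewrite !dotBr; lra.
  by move=> /filter_ex[].
(* For late [n] a point [e] away from [x0] is [e / 2] away from [u n]; the midpoint inequality
   halves this again. *)
move=> e e0; have e40 : 0 < e / 4 by lra.
have [d d0 hd] := grow _ e40.
exists (d / 2) => [|x a Gx ex]; first by rewrite divr_gt0.
apply/ler_addgt0Pr => k k0.
have k20 : 0 < k / 2 by lra.
have e20 : 0 < e / 2 by lra.
have : \forall n \near \oo, d / 2 * `|x - x0| <= a - dot x y + b + k.
  have := small _ k0.
  have /cvgrPdist_lt/(_ _ e20) := cvu; apply: filterS2 => n h1 h2.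
  have h3 : `|x - x0| <= 2 * `|x - u n|.
    have : `|x - x0| <= `|x - u n| + `|x0 - u n|.
      rewrite -[`|x0 - _|]normrN opprB.
      have -> : x - x0 = (x - u n) + (u n - x0) by rewrite addrA subrK.
      exact: ler_normD.
    lra.
  have := hd (2^-1 *: (x - u n)); rewrite subr0 normrZ gtr0_norm ?invr_gt0//.
  have h4 : e / 4 <= 2^-1 * `|x - u n| by lra.
  move=> /(_ h4) /le_trans/(_ (mid _ _ _ _ Gx (proj1 (hu n)))); rewrite lee_fin.
  have : d * `|x - x0| <= d * (2 * `|x - u n|) by rewrite ler_pM2l.
  lra.
by move=> /filter_ex[].
Qed.

End Shift.

(** * Rescaling of functions, gradients and energies *)

Section Rescale.
Context {R : realType} {m : nat}.
Local Notation V := ('rV[R]_m).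
Implicit Types (f G Psi : V -> \bar R) (x y z mu nu g : V).
Variables (a b c : R).
Hypotheses (a0 : 0 < a) (b0 : 0 < b).

Lemma rescale_fin G x (p : R) : G (b *: x) = p%:E ->
  rescale a b c G x = (a * p + c)%:E.
Proof. by rewrite /rescale => ->; rewrite -EFinM -EFinD. Qed.

Lemma rescale_pinfty G x : G (b *: x) = +oo%E -> rescale a b c G x = +oo%E.
Proof. by rewrite /rescale => ->; rewrite gt0_muley ?lte_fin. Qed.

Lemma rescale_ninfty G x : G (b *: x) = -oo%E -> rescale a b c G x = -oo%E.
Proof. by rewrite /rescale => ->; rewrite gt0_muleNy ?lte_fin. Qed.

Lemma rescale_gtNy G x : (-oo < G (b *: x))%E -> (-oo < rescale a b c G x)%E.
Proof.
case E : (G _) => [p| |]// _; first by rewrite (rescale_fin E) ltNyr.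
by rewrite rescale_pinfty.
Qed.

Lemma rescale_dom G x : dom (rescale a b c G) x <-> dom G (b *: x).
Proof.
rewrite /dom /=; case E : (G _) => [p| |]; last by rewrite rescale_ninfty.
  by rewrite (rescale_fin E) !ltry.
by rewrite rescale_pinfty.
Qed.

Lemma near_scale x (P : set V) :
  (\forall y \near x, P (b *: y)) <-> (\forall y \near b *: x, P y).
Proof.
split=> /nearvP[d d0 hd]; apply/nearvP.
  exists (b * d) => [|z zd]; first by rewrite mulr_gt0.
  have := hd (b^-1 *: z); rewrite scalerDr scalerA divff ?gt_eqF// scale1r; apply.
  by rewrite normrZ gtr0_norm ?invr_gt0// mulrC ltr_pdivrMr// mulrC.
exists (d / b) => [|z zd]; first by rewrite divr_gt0.
by rewrite scalerDr; apply: hd; rewrite normrZ gtr0_norm// mulrC -ltr_pdivlMr.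
Qed.

Lemma rescale_interior G x :
  (dom (rescale a b c G))° x <-> (dom G)° (b *: x).
Proof.
split=> h; first by apply/near_scale; apply: filterS h => y /rescale_dom.
by have := iffRL (near_scale x (dom G)) h; apply: filterS => y /rescale_dom.
Qed.

Lemma rescale_expansion G x g : expansion G (b *: x) g ->
  expansion (rescale a b c G) x ((a * b) *: g).
Proof.
move=> ex e e0; have ab0 : 0 < a * b by rewrite mulr_gt0.
have e1 : 0 < e / (a * b) by rewrite divr_gt0.
have [p Gx] := expansion_fin ex; have [d d0 hd] := ex _ e1.
exists (d / b) => [|z zd]; first by rewrite divr_gt0.
have [|Gz h] := hd (b *: z).
  by rewrite normrZ gtr0_norm// mulrC -ltr_pdivlMr.
rewrite -scalerDr in Gz h.
rewrite (rescale_fin Gx); move: h; rewrite -(fineK Gz) Gx /= => h.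
rewrite (rescale_fin (esym (fineK Gz))) /=; split => //.
have -> : a * fine (G (b *: (x + z))) + c - (a * p + c) - dot ((a * b) *: g) z =
    a * (fine (G (b *: (x + z))) - p - dot g (b *: z)) by rewrite !dotE; ring.
rewrite normrM gtr0_norm// mulrC -ler_pdivlMr//; apply: le_trans h _.
rewrite normrZ (gtr0_norm b0) le_eqVlt; apply/orP; left; apply/eqP.
by field; rewrite !gt_eqF.
Qed.

End Rescale.

Section RescaleEnergy.
Context {R : realType} {m : nat}.
Local Notation V := ('rV[R]_m).
Implicit Types (f G Psi : V -> \bar R) (x y z mu nu g : V).

Lemma rescaleK G (a b c : R) : 0 < a -> 0 < b ->
  rescale a^-1 b^-1 (- (c / a)) (rescale a b c G) = G.
Proof.
move=> a0 b0; apply/funext => x; have bE : b *: (b^-1 *: x) = x.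
  by rewrite scalerA divff ?gt_eqF// scale1r.
case E : (G x) => [p| |]; rewrite -{1}bE in E.
- rewrite (rescale_fin _ _ (rescale_fin _ c E)); congr (_%:E).
  by field; rewrite gt_eqF.
- by rewrite rescale_pinfty ?invr_gt0// rescale_pinfty.
- by rewrite rescale_ninfty ?invr_gt0// rescale_ninfty.
Qed.

(** Rescaling back shows that differentiability fails on both sides together, where both gradients
    are 0 by convention. *)
Lemma rescale_grad G (a b c : R) x : 0 < a -> 0 < b ->
  grad (rescale a b c G) x = (a * b) *: grad G (b *: x).
Proof.
move=> a0 b0; have [dG|nG] := pselect (differentiable_at G (b *: x)).
  have := rescale_expansion c a0 b0 (differentiable_expansion dG).
  by move=> /expansionP[].
rewrite [in RHS]/grad asboolF// scaler0 /grad asboolF// => dF; apply: nG.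
have := differentiable_expansion dF.
have {1}-> : x = b^-1 *: (b *: x) by rewrite scalerA mulVf ?gt_eqF// scale1r.
have a0' : 0 < a^-1 by rewrite invr_gt0.
have b0' : 0 < b^-1 by rewrite invr_gt0.
move=> /(rescale_expansion (- (c / a)) a0' b0'); rewrite rescaleK//.
exact: expansion_differentiable.
Qed.

Lemma rescale_taylor_rem G (a b c : R) mu nu (p q : R) : 0 < a -> 0 < b ->
  G (b *: mu) = p%:E -> G (b *: nu) = q%:E ->
  taylor_rem (rescale a b c G) mu nu =
  (a%:E * taylor_rem G (b *: mu) (b *: nu))%E.
Proof.
move=> a0 b0 Gmu Gnu; rewrite (taylor_remE (rescale_fin _ c Gmu) (rescale_fin _ c Gnu)).
rewrite (taylor_remE Gmu Gnu) rescale_grad// -EFinM; congr (_%:E).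
by rewrite -scalerBr dotZl dotZr; ring.
Qed.

Lemma mule_conv (a t : R) (p q : \bar R) : 0 < a -> 0 < t -> t < 1 ->
  (-oo < p)%E -> (-oo < q)%E ->
  (t%:E * (a%:E * p) + (1 - t)%:E * (a%:E * q) =
   a%:E * (t%:E * p + (1 - t)%:E * q))%E.
Proof.
move=> a0 t0 t1; have t1' : 0 < 1 - t by lra.
case: p => [p| |]// _; case: q => [q| |]// _.
- by rewrite -!EFinM -!EFinD; congr (_%:E); ring.
- by rewrite !(gt0_muley, lte_fin)// addey// gt0_muley ?lte_fin// addey.
- by rewrite !(gt0_muley, lte_fin)// addye// gt0_muley ?lte_fin// addye.
- by rewrite !(gt0_muley, lte_fin).
Qed.

Lemma rescale0E (a b : R) G x : rescale a b 0 G x = (a%:E * G (b *: x)%R)%E.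
Proof. by rewrite /rescale adde0. Qed.

Lemma rescale_essentially_smooth (a b : R) G : 0 < a -> 0 < b ->
  essentially_smooth G -> essentially_smooth (rescale a b 0 G).
Proof.
move=> a0 b0 [[y iy] dG blow]; split.
- exists (b^-1 *: y); apply/rescale_interior => //.
  by rewrite scalerA divff ?gt_eqF// scale1r.
- move=> x /(rescale_interior _ a0 b0) /dG /differentiable_expansion.
  by move=> /(rescale_expansion 0 a0 b0); exact: expansion_differentiable.
- move=> u x iu cu nx.
  have cbu : (fun n => b *: u n) @ \oo --> b *: x by exact: cvgZl_tmp.
  have := blow _ _ (fun n => iffLR (rescale_interior 0 a0 b0 G (u n)) (iu n)) cbu.
  move=> /(_ (fun h => nx (iffRL (rescale_interior 0 a0 b0 G x) h))).
  have ab0 : 0 < a * b by rewrite mulr_gt0.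
  move=> /cvgryPgt big; apply/cvgryPgt => A.
  apply: filterS (big (A / (a * b))) => n.
  by rewrite rescale_grad// normrZ gtr0_norm// ltr_pdivrMr// mulrC.
Qed.

Lemma rescale_essentially_strictly_convex (a b : R) G :
  0 < a -> 0 < b -> (forall x, (-oo < G x)%E) ->
  essentially_strictly_convex G -> essentially_strictly_convex (rescale a b 0 G).
Proof.
move=> a0 b0 GN sc C subC /convex_setP cC x y t Cx Cy xy t0 t1.
(* [D] is [C] scaled by [b], the set on which strict convexity of [G] is used. *)
pose D := [set z | C (b^-1 *: z)].
have bK z : b^-1 *: (b *: z) = z by rewrite scalerA mulVf ?gt_eqF// scale1r.
have bK' z : b *: (b^-1 *: z) = z by rewrite scalerA divff ?gt_eqF// scale1r.
have conv u v : b *: (t *: u + (1 - t) *: v) = t *: (b *: u) + (1 - t) *: (b *: v).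
  by rewrite scalerDr !scalerA !(mulrC b).
rewrite !rescale0E mule_conv// conv lte_pmul2l ?lte_fin//.
apply: (sc D) => //; rewrite ?/D /= ?bK//.
- move=> z /subC[g [dz sub]]; exists ((a * b)^-1 *: g).
  move/rescale_dom : dz; rewrite bK' => /(_ a0) dz; split => // w.
  have [p Gz] := fin_dom (GN _) dz.
  case Gw : (G w) (GN w) => [q| |]// _; last by rewrite leey.
  have := sub (b^-1 *: w); rewrite !rescale0E !bK' Gz Gw -!EFinM -EFinD !lee_fin.
  rewrite -scalerBr dotZr dotZl => h.
  by rewrite -(ler_pM2l a0) mulrDr invfM !mulrA divff ?gt_eqF// mul1r.
- apply/convex_setP => u v s Du Dv s0 s1; rewrite /D /=.
  rewrite scalerDr !scalerA !(mulrC b^-1) -!scalerA.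
  exact: cC.
- by apply: contra xy => /eqP/(congr1 ( *:%R b^-1)); rewrite !bK => ->.
Qed.

Lemma rescale_energy (a b : R) Psi : 0 < a -> 0 < b ->
  energy Psi -> energy (rescale a b 0 Psi).
Proof.
move=> a0 b0 [[[PN [x0 dx0]] lP cP smP scP] minP [N [fo [nN PE]]]].
split; [split|..].
- split=> [x|]; first by apply: rescale_gtNy => //; exact: PN.
  exists (b^-1 *: x0); apply/rescale_dom => //.
  by rewrite scalerA divff ?gt_eqF// scale1r.
- move=> x t; rewrite rescale0E => tx.
  have [|U xU UP] := lP (b *: x) (t / a).
    by rewrite -(@lte_pmul2l _ a%:E) ?lte_fin// -EFinM mulrC divfK ?gt_eqF.
  exists [set x' | U (b *: x')]; first exact/near_scale.
  move=> y /UP; rewrite rescale0E -(@lte_pmul2l _ a%:E) ?lte_fin//.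
  by rewrite -EFinM mulrC divfK ?gt_eqF.
- move=> x y t t0 t1; rewrite !rescale0E mule_conv// lee_pmul2l ?lte_fin//.
  by rewrite scalerDr !scalerA !(mulrC b) -!scalerA; exact: cP.
- exact: rescale_essentially_smooth.
- exact: rescale_essentially_strictly_convex.
- move=> x x_neq0; rewrite !rescale0E scaler0 lte_pmul2l ?lte_fin//.
  by apply: minP; rewrite scaler_eq0 negb_or gt_eqF.
- exists N, (fun s => a%:E * fo (b * s)%R)%E; split => // x.
  by rewrite rescale0E PE; have [_ -> _] := nN; rewrite gtr0_norm.
Qed.

Lemma H_smooth_rescale G Psi (a b c : R) : (forall x, (-oo < G x)%E) ->
  0 < a -> 0 < b -> H_smooth Psi G ->
  H_smooth (rescale a b 0 Psi) (rescale a b c G).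
Proof.
move=> GN a0 b0 [eP sm]; split; first exact: rescale_energy.
move=> mu nu /(rescale_dom _ _ a0) dmu /(rescale_dom _ _ a0) dnu.
have [p Gmu] := fin_dom (GN _) dmu; have [q Gnu] := fin_dom (GN _) dnu.
rewrite (rescale_taylor_rem c a0 b0 Gmu Gnu) rescale0E lee_pmul2l ?lte_fin//.
by rewrite scalerBr; exact: sm.
Qed.

Lemma H_convex_rescale G psi (a b c : R) : (forall x, (-oo < G x)%E) ->
  0 < a -> 0 < b -> H_convex psi G ->
  H_convex (rescale a b 0 psi) (rescale a b c G).
Proof.
move=> GN a0 b0 [eP sm]; split; first exact: rescale_energy.
move=> mu nu /(rescale_dom _ _ a0) dmu /(rescale_dom _ _ a0) dnu.
have [p Gmu] := fin_dom (GN _) dmu; have [q Gnu] := fin_dom (GN _) dnu.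
rewrite (rescale_taylor_rem c a0 b0 Gmu Gnu) rescale0E lee_pmul2l ?lte_fin//.
by rewrite scalerBr; exact: sm.
Qed.

End RescaleEnergy.

(** * Averages over a dataset *)

Section DatasetMean.
Context {R : realType} {m : nat}.
Local Notation V := ('rV[R]_m).
Implicit Types (f : V -> \bar R) (x y z mu nu g : V).

Lemma sum_gtNy (I : Type) (r : seq I) (P : pred I) (F : I -> \bar R) :
  (forall i, (-oo < F i)%E) -> (-oo < \sum_(i <- r | P i) F i)%E.
Proof.
move=> FN; elim/big_ind : _ => // p q.
by case: p => [p| |]//; case: q => [q| |]//; rewrite ?ltNyr.
Qed.

Lemma expansion_sum (I : Type) (r : seq I) (F : I -> V -> \bar R) (g : I -> V) x :
  (forall i, expansion (F i) x (g i)) ->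
  expansion (fun y => \sum_(i <- r) F i y)%E x (\sum_(i <- r) g i).
Proof.
move=> ex; elim: r => [|i r ih] e e0.
  exists 1 => // z _; rewrite !big_nil; split => //.
  by rewrite dot0l !subr0 normr0 mulr_ge0// ltW.
have e20 : 0 < e / 2 by lra.
have [d d0 hd] := ex i _ e20; have [d' d'0 hd'] := ih _ e20.
exists (Num.min d d'); first by rewrite lt_min d0.
move=> z; rewrite lt_min => /andP[/hd[f1 h1] /hd'[f2 h2]].
have [p Fp] := expansion_fin (ex i); have [q Fq] := expansion_fin ih.
rewrite !big_cons Fp Fq -(fineK f1) -(fineK f2) -!EFinD /=; split => //.
move: h1 h2; rewrite Fp Fq /= !ler_norml dotDl => /andP[h1 h2] /andP[h3 h4].
by apply/andP; split; lra.
Qed.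

Variables (Z : Type) (n : nat) (s : n.-tuple Z) (G : Z -> V -> \bar R).
Hypotheses (n0 : (0 < n)%N) (GN : forall w x, (-oo < G w x)%E).

Let n0' : 0 < n%:R :> R. Proof. by rewrite ltr0n. Qed.
Let nV0 : 0 < n%:R^-1 :> R. Proof. by rewrite invr_gt0. Qed.

Lemma dataset_mean_dom x : dom (dataset_mean s G) x ->
  forall i, dom (G (tnth s i)) x.
Proof.
move=> dx i; rewrite /dom /= ltey; apply/eqP => Gi; move: dx.
rewrite /dom /dataset_mean /= (bigD1 i)//= Gi addye.
  by rewrite gt0_muley ?lte_fin// ltxx.
by rewrite gt_eqF//; exact: sum_gtNy.
Qed.

Lemma dataset_mean_fin x (p : 'I_n -> R) :
  (forall i, G (tnth s i) x = (p i)%:E) ->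
  dataset_mean s G x = (n%:R^-1 * \sum_i p i)%:E.
Proof.
move=> Gp; rewrite /dataset_mean (eq_bigr (fun i => (p i)%:E)) ?sumEFin//.
Qed.

(** Either all gradients exist and add up, or all of them and that of the mean are 0 by
    convention. *)
Lemma dataset_mean_grad x : uniformly_differentiable_or_not s G ->
  dom (dataset_mean s G) x ->
  grad (dataset_mean s G) x = n%:R^-1 *: \sum_(i < n) grad (G (tnth s i)) x.
Proof.
move=> ud /ud[dG|[nG nM]]; last first.
  rewrite /grad asboolF// big1 ?scaler0// => i _.
  by rewrite asboolF//; exact: nG.
have meanE : dataset_mean s G =
    rescale n%:R^-1 1 0 (fun y => \sum_(i < n) G (tnth s i) y)%E.
  by apply/funext => y; rewrite rescale0E scale1r.
have ex : expansion (fun y => \sum_(i < n) G (tnth s i) y)%E (1 *: x)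
    (\sum_(i < n) grad (G (tnth s i)) x).
  rewrite scale1r; apply: expansion_sum => i.
  exact: differentiable_expansion (dG i).
have := rescale_expansion 0 nV0 ltr01 ex; rewrite -meanE mulr1.
by move=> /expansionP[].
Qed.

Lemma dataset_mean_taylor_rem mu nu (p q : 'I_n -> R) :
  uniformly_differentiable_or_not s G ->
  (forall i, G (tnth s i) mu = (p i)%:E) ->
  (forall i, G (tnth s i) nu = (q i)%:E) ->
  taylor_rem (dataset_mean s G) mu nu = (n%:R^-1 *
    \sum_(i < n) (p i - q i - dot (grad (G (tnth s i)) nu) (mu - nu)))%:E.
Proof.
move=> ud Gmu Gnu.
rewrite (taylor_remE (dataset_mean_fin Gmu) (dataset_mean_fin Gnu)).
rewrite dataset_mean_grad//; last exact: dom_fin (dataset_mean_fin Gnu).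
congr (_%:E); rewrite dotZl -!mulrBr !sumrB; congr (_ * (_ - _)).
rewrite dotC; elim/big_ind2 : _ => [|u v u' v' <- <-|i _]; last exact: dotC.
  by rewrite dot0r.
by rewrite dotDr.
Qed.

Lemma mean_le (F : 'I_n -> R) (b : R) : (forall i, F i <= b) ->
  n%:R^-1 * \sum_i F i <= b.
Proof.
move=> h; rewrite mulrC ler_pdivrMr//.
by rewrite (le_trans (ler_sum _ (fun i _ => h i)))// sumr_const card_ord mulr_natr.
Qed.

Lemma mean_ge (F : 'I_n -> R) (b : R) : (forall i, b <= F i) ->
  b <= n%:R^-1 * \sum_i F i.
Proof.
move=> h; rewrite mulrC ler_pdivlMr//.
by rewrite (le_trans _ (ler_sum _ (fun i _ => h i)))// sumr_const card_ord mulr_natr.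
Qed.

Lemma H_smooth_mean Psi : uniformly_differentiable_or_not s G ->
  (forall w, H_smooth Psi (G w)) -> H_smooth Psi (dataset_mean s G).
Proof.
move=> ud sm; have [eP _] := sm (tnth s (Ordinal n0)).
split=> // mu nu dmu dnu.
have [p Gmu] := choice (fun i => fin_dom (GN _ _) (dataset_mean_dom dmu i)).
have [q Gnu] := choice (fun i => fin_dom (GN _ _) (dataset_mean_dom dnu i)).
have := fun i => proj2 (sm (tnth s i)) _ _ (dom_fin (Gmu i)) (dom_fin (Gnu i)).
rewrite (dataset_mean_taylor_rem ud Gmu Gnu).
have [[[PN _] _ _ _ _] _ _] := eP.
case: (Psi _) (PN (mu - nu)) => [b| |]// _ h; last by rewrite leey.
rewrite lee_fin; apply: mean_le => i.
by have := h i; rewrite (taylor_remE (Gmu i) (Gnu i)) lee_fin.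
Qed.

Lemma H_convex_mean psi : uniformly_differentiable_or_not s G ->
  (forall w, H_convex psi (G w)) -> H_convex psi (dataset_mean s G).
Proof.
move=> ud sm; have [eP _] := sm (tnth s (Ordinal n0)).
split=> // mu nu dmu dnu.
have [p Gmu] := choice (fun i => fin_dom (GN _ _) (dataset_mean_dom dmu i)).
have [q Gnu] := choice (fun i => fin_dom (GN _ _) (dataset_mean_dom dnu i)).
have := fun i => proj2 (sm (tnth s i)) _ _ (dom_fin (Gmu i)) (dom_fin (Gnu i)).
rewrite (dataset_mean_taylor_rem ud Gmu Gnu).
have [[[PN _] _ _ _ _] _ _] := eP.
(* The value [+oo] is excluded by the finite remainder of any one data point. *)
case: (psi _) (PN (mu - nu)) => [b| |]// _ h; last first.
  by have := h (Ordinal n0); rewrite (taylor_remE (Gmu _) (Gnu _)).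
rewrite lee_fin; apply: mean_ge => i.
by have := h i; rewrite (taylor_remE (Gmu i) (Gnu i)) lee_fin.
Qed.

End DatasetMean.

(** * Assembly of the four claims *)

Theorem proposition4 (R : realType) (m : nat) :
  (* (1) *)
  (forall G Psi : 'rV[R]_m -> \bar R,
     standing G -> standing (conjugate G) -> lower_semicontinuous G ->
     differentiable_on_dom G -> differentiable_on_dom (conjugate G) ->
     energy Psi ->
     (H_smooth Psi G <-> H_convex (conjugate Psi) (conjugate G)))
  /\
  (* (2) *)
  (forall (G : 'rV[R]_m -> \bar R) (a b c : R),
     standing G -> 0 < a -> 0 < b ->
     (forall Psi : 'rV[R]_m -> \bar R, H_smooth Psi G ->
        H_smooth (rescale a b 0 Psi) (rescale a b c G)) /\
     (forall psi : 'rV[R]_m -> \bar R, H_convex psi G ->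
        H_convex (rescale a b 0 psi) (rescale a b c G)))
  /\
  (* (3) *)
  (forall (Z : Type) (G : Z -> 'rV[R]_m -> \bar R) (n : nat) (s : n.-tuple Z),
     (0 < n)%N -> (forall z, standing (G z)) ->
     uniformly_differentiable_or_not s G ->
     (forall Psi : 'rV[R]_m -> \bar R,
        (forall z, H_smooth Psi (G z)) -> H_smooth Psi (dataset_mean s G)) /\
     (forall psi : 'rV[R]_m -> \bar R,
        (forall z, H_convex psi (G z)) -> H_convex psi (dataset_mean s G)))
  /\
  (* (4) *)
  (forall (G psi : 'rV[R]_m -> \bar R) (s : 'rV[R]_m),
     standing G -> H_convex psi G ->
     (dom (conjugate G) s -> differentiable_on_dom G ->
        (forall Phi : 'rV[R]_m -> \bar R,
           H_smooth Phi (fun mu => fenchel_young G mu s) <-> H_smooth Phi G) /\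
        (forall phi : 'rV[R]_m -> \bar R,
           H_convex phi (fun mu => fenchel_young G mu s) <-> H_convex phi G)) /\
     (dom G s ->
        ((psi 0%R < 0)%E -> differentiable_on_dom (conjugate G)) ->
        (forall Phi : 'rV[R]_m -> \bar R,
           H_smooth Phi (fun nu => fenchel_young G s nu) <->
           H_smooth Phi (conjugate G)) /\
        (forall phi : 'rV[R]_m -> \bar R,
           H_convex phi (fun nu => fenchel_young G s nu) <->
           H_convex phi (conjugate G)))).

Proof.
split; last split; last split.
- move=> G Psi [pG _ _] [[_ neGs] _ _] lG dG dGs eP; split.
    exact: H_smooth_conjugate.
  exact: H_convex_conjugate.
- move=> G a b c [[GN _] _ _] a0 b0; split=> Psi.
    exact: H_smooth_rescale.
  exact: H_convex_rescale.
- move=> Z G n s n0 st ud.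
  have GN z x : (-oo < G z x)%E by have [[]] := st z.
  by split=> Psi; [exact: H_smooth_mean|exact: H_convex_mean].
move=> G psi s stG cvG; have [pG _ _] := stG; have [GN _] := pG; split.
  move=> ds dG; have [c Gs] := fin_dom (conj_gtNy _ pG) ds.
  rewrite (fenchel_youngl Gs).
  by split=> Phi; [exact: H_smooth_tilt|exact: H_convex_tilt].
move=> ds dneg; have [c Gs] := fin_dom (GN _) ds.
rewrite (fenchel_youngr Gs).
have dGs : differentiable_on_dom (conjugate G).
  (* Differentiability of the conjugate is assumed for [psi 0 < 0] and derived from convexity
     otherwise. *)
  have [/dneg//|p0] := ltP (psi 0) 0%E.
  exact: H_convex_conj_differentiable stG cvG p0.
have GsN y := conj_gtNy y pG.
by split=> Phi; [exact: H_smooth_tilt|exact: H_convex_tilt].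
Qed.
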